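(* Let $\mu$ be a finite discrete positive measure on $\mathbb{T}$, let $\phi$ be an elliptic automorphism of $\mathbb{D}$ fixing $0$, and suppose $\phi'(0)$ is a primitive $n$-th root of unity for some $n\in\mathbb{N}$. Then $S_\mu$ is an eigenfunction of $C_\phi$ if and only if $\mu$ has the form $$\mu=\sum_{m}a_m\sum_{k=0}^{n-1}\delta_{\phi^{[k]}(w_m)},$$ where $\{a_m\}$ is a (possibly finite) sequence of positive real numbers with $\sum_m a_m<\infty$ and $\{w_m\}$ is a sequence of points on the unit circle $\mathbb{T}$ (with the same index set).
   Context: $\mathbb{D}$ is the open unit disk and $\mathbb{T}$ the unit circle. An elliptic automorphism of $\mathbb{D}$ is a non-identity biholomorphic self-map of $\mathbb{D}$ with exactly one fixed point in $\mathbb{D}$; it extends to a bijection of $\mathbb{T}$. $\phi^{[k]}$ denotes the $k$-fold composition of $\phi$ ($\phi^{[0]}$ is the identity). $\delta_p$ is the Dirac measure at $p\in\mathbb{T}$. $C_\phi f=f\circ\phi$ is the composition operator on the Hardy space $H^2(\mathbb{D})$. For a finite positive Borel measure $\mu$ on $\mathbb{T}$, $S_\mu(z)=\exp\left(-\int_{\mathbb{T}}\frac{t+z}{t-z}\,d\mu(t)\right)$, $z\in\mathbb{D}$. A measure $\mu$ on $\mathbb{T}$ is discrete if there is a countable $A\subset\mathbb{T}$ with $\mu(\mathbb{T}\setminus A)=0$. $S_\mu$ is an eigenfunction of $C_\phi$ if $S_\mu\circ\phi=\lambda S_\mu$ for some constant $\lambda$. An empty sum is the zero measure. *)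

(* Defs.v *)
From HB Require Import structures.
From mathcomp Require Import all_boot all_order all_algebra.
From mathcomp Require Import all_classical all_reals all_analysis.
From mathcomp.real_closed Require Import complex.

Set Implicit Arguments.
Unset Strict Implicit.
Unset Printing Implicit Defensive.

Import Order.TTheory GRing.Theory Num.Theory.
Import numFieldNormedType.Exports.

Local Open Scope classical_set_scope.
Local Open Scope ring_scope.
Local Open Scope complex_scope.

(* R[i] as a normed space over itself: for f : R[i] -> R[i], [derivable f z 1]
   and [derive1 f z] are complex differentiability and the complex derivative.    *)
HB.instance Definition _ (R : realType) := NormedModule.copy R[i] (R[i])^o.

Section Disk.
Variable R : realType.
Implicit Types (f phi psi : R[i] -> R[i]) (z : R[i]).

(* The norm of z : R[i] is itself in R[i]; x < y there means that y - x is a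
   positive real, so this is the usual |z| < 1.                               *)
Definition unit_disk : set R[i] := [set z | `|z| < 1].

Definition holomorphic_on_disk f := forall z, unit_disk z -> derivable f z 1.

(* Only the values of phi on the disk matter. *)
Definition disk_automorphism phi :=
  [/\ holomorphic_on_disk phi,
      (forall z, unit_disk z -> unit_disk (phi z)) &
      exists psi, [/\ holomorphic_on_disk psi,
        (forall z, unit_disk z -> unit_disk (psi z)),
        (forall z, unit_disk z -> psi (phi z) = z) &
        (forall z, unit_disk z -> phi (psi z) = z)]].

Definition elliptic_automorphism phi :=
  [/\ disk_automorphism phi,
      (exists2 z, unit_disk z & phi z <> z) &
      exists! z, unit_disk z /\ phi z = z].

Definition composition_operator phi f : R[i] -> R[i] := f \o phi.

Definition eigenfunction_of_composition phi f :=
  exists lambda : R[i], forall z, unit_disk z ->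
    composition_operator phi f z = lambda * f z.

Definition cexp z : R[i] :=
  expR (complex.Re z) * cos (complex.Im z)
  +i* (expR (complex.Re z) * sin (complex.Im z)).

End Disk.

Section Circle.
Variable R : realType.

Definition unit_circle : set R[i] := [set z | `|z| = 1].

Definition circle : Type := unit_circle.

(* The subspace topology inherited from R[i]. *)
HB.instance Definition _ := Topological.copy circle (set_type unit_circle).

Fact unit_circle1 : 1 \in unit_circle.
Proof. by rewrite inE /unit_circle /= normr1. Qed.

HB.instance Definition _ :=
  isPointed.Build circle (exist _ 1 unit_circle1 : set_type unit_circle).

(* The circle with its Borel sigma-algebra. *)
Definition borel_circle := g_sigma_algebraType (@open circle).

Definition circle_val (t : borel_circle) : R[i] :=
  set_val (t : set_type unit_circle).

(* The extension of phi to the circle by its boundary limits: the point v of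
   the circle such that phi z tends to v as z tends to w inside the disk.
   When there is no such v, which does not happen for an automorphism of the
   disk, the value is the irrelevant default w.                               *)
Definition boundary_map (phi : R[i] -> R[i]) (w : borel_circle) :
    borel_circle :=
  xget w [set v | phi z @[z --> within (@unit_disk R) (nbhs (circle_val w))]
                    --> circle_val v].

Definition cintegral (mu : {measure set borel_circle -> \bar R})
    (f : borel_circle -> R[i]) : R[i] :=
  \int[mu]_t complex.Re (f t) +i* \int[mu]_t complex.Im (f t).

Definition singular_inner (mu : {measure set borel_circle -> \bar R}) (z : R[i]) :
    R[i] :=
  cexp (- cintegral mu (fun t => (circle_val t + z) / (circle_val t - z))).

Definition discrete_measure (mu : {measure set borel_circle -> \bar R}) :=
  exists2 A : set borel_circle, countable A & mu (~` A) = 0%E.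

(* The mass that the sum over m in I of
   a m * (dirac (w m) + dirac (phi (w m)) + ... + dirac (phi^[n-1] (w m)))
   gives to B.                                                                *)
Definition orbit_mass (phi : R[i] -> R[i]) (n : nat) (I : set nat)
    (a : nat -> R) (w : nat -> borel_circle) (B : set borel_circle) : \bar R :=
  (\esum_(m in I)
     ((a m)%:E * \sum_(k < n) \d_(iter k (boundary_map phi) (w m)) B))%E.

End Circle.

(* Main.v *)
(* An automorphism fixing 0 whose derivative c at 0 has modulus 1 is the rotation
   z |-> c z: by the maximum principle |phi z / z| <= 1, and equality at 0 forces
   phi z / z to be constant. The maximum principle comes from the mean value
   property on circles, which is Goursat's argument in the logarithmic coordinate
   zeta |-> z1 + exp zeta, where a circle becomes a vertical segment.

   The logarithm of |S_mu| is minus the Poisson integral P of mu. If S_mu is an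
   eigenfunction with eigenvalue lambda, then |lambda| = 1 because c 0 = 0, so P is
   invariant under the rotation. The mass mu {t} is the limit of
   (1 - r) / (1 + r) * P (r t) as r tends to 1, hence the atoms of mu have
   rotation-invariant masses; choosing one point in each orbit of atoms gives the
   decomposition. Conversely a sum over orbits is a rotation-invariant measure,
   and the change of variables t |-> c t gives S_mu (c z) = S_mu z. *)
Require Import Defs.
From HB Require Import structures.
From mathcomp Require Import all_boot all_order all_algebra.
From mathcomp Require Import all_classical all_reals all_analysis.
From mathcomp.real_closed Require Import complex.
From mathcomp Require Import measurable_realfun ring lra.

Set Implicit Arguments.
Unset Strict Implicit.
Unset Printing Implicit Defensive.

Import Order.TTheory GRing.Theory Num.Theory.
Import numFieldNormedType.Exports.

Local Open Scope classical_set_scope.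
Local Open Scope ring_scope.
Local Open Scope complex_scope.

Import Normc.

(** * Goursat's theorem on rectangles *)

Section SegmentIntegral.
Variable R : realType.
Implicit Types (f g : R -> R) (a b : R).

(** The integral is unoriented, and is 0 when [b < a]; orientation signs are written out where the
    sides of a rectangle are traversed. *)
Definition segint f a b : R := \int[lebesgue_measure]_(x in `[a, b]) f x.

Lemma segint_integrable f a b :
  (forall x, x \in `[a, b] -> {for x, continuous f}) ->
  lebesgue_measure.-integrable `[a, b] (EFin \o f).
Proof.
move=> fc; apply: continuous_compact_integrable; first exact: segment_compact.
by apply: continuous_in_subspaceT => x; rewrite inE => /fc.
Qed.

Lemma segint_split f a m b : a <= m -> m <= b ->
  (forall x, x \in `[a, b] -> {for x, continuous f}) ->
  segint f a b = segint f a m + segint f m b.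
Proof.
move=> am mb /segint_integrable fi; rewrite /segint.
have := @Rintegral_itvB R f (BLeft a) (BRight b) m fi.
rewrite !bnd_simp => /(_ am mb).
rewrite Rintegral_itv_obnd_cbnd => [<-|]; first by ring.
by apply: integrableS fi => //; apply: subset_itvr; rewrite bnd_simp.
Qed.

Lemma segint_cst (k a b : R) : a <= b -> segint (fun=> k) a b = k * (b - a).
Proof.
move=> ab; rewrite /segint Rintegral_cst//= lebesgue_measure_itv/= lte_fin.
by case: ltP => //= ba; have -> : b = a by [apply/le_anti/andP]; rewrite subrr.
Qed.

Lemma segintB f g a b :
  (forall x, x \in `[a, b] -> {for x, continuous f}) ->
  (forall x, x \in `[a, b] -> {for x, continuous g}) ->
  segint (fun x => f x - g x) a b = segint f a b - segint g a b.
Proof.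
by move=> /segint_integrable fi /segint_integrable gi; rewrite /segint RintegralB.
Qed.

Lemma segint_le f g a b :
  (forall x, x \in `[a, b] -> {for x, continuous f}) ->
  (forall x, x \in `[a, b] -> {for x, continuous g}) ->
  (forall x, x \in `[a, b] -> f x <= g x) -> segint f a b <= segint g a b.
Proof.
move=> /segint_integrable fi /segint_integrable gi fg.
by apply: le_Rintegral => // x /fg.
Qed.

Lemma segint_near_cst f (k e a b : R) : a <= b ->
  (forall x, x \in `[a, b] -> {for x, continuous f}) ->
  (forall x, x \in `[a, b] -> `|f x - k| <= e) ->
  `|segint f a b - k * (b - a)| <= e * (b - a).
Proof.
move=> ab fc fk; rewrite ler_norml; apply/andP; split.
- have : segint (fun=> k - e) a b <= segint f a b.
    apply: segint_le => // [x _|x /fk]; first exact: cvg_cst.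
    by rewrite ler_norml; lra.
  by rewrite segint_cst// mulrBl; lra.
- have : segint f a b <= segint (fun=> k + e) a b.
    apply: segint_le => // [x _|x /fk]; first exact: cvg_cst.
    by rewrite ler_norml; lra.
  by rewrite segint_cst// mulrDl; lra.
Qed.

End SegmentIntegral.

(** * Bisection of rectangles for a form P dx + Q dy on a half-plane *)

Section Goursat.
Variables (R : realType) (P Q : R -> R -> R) (X : R).

(* P_y = Q_x at (x0, y0), to first order along vertical segments for P and
   along horizontal ones for Q. *)
Definition exact_at (x0 y0 : R) := exists beta : R, forall e, 0 < e ->
  exists2 d, 0 < d & forall r x y t, r <= d -> `|x - x0| <= r ->
    `|y - y0| <= r ->
    (`|t - y0| <= r -> `|P x y - P x t - beta * (y - t)| <= e * r) /\
    (`|t - x0| <= r -> `|Q x y - Q t y - beta * (x - t)| <= e * r).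

Hypothesis exPQ : forall x y, x < X -> exact_at x y.
Hypothesis contP : forall x y, x < X -> {for x, continuous (P ^~ y)}.
Hypothesis contQ : forall x y, x < X -> {for y, continuous (Q x)}.

(** The line integral of P dx + Q dy along the counterclockwise boundary of [a, b] x [c, d]. *)
Definition circulation (a b c d : R) : R :=
  segint (P ^~ c) a b - segint (P ^~ d) a b + segint (Q b) c d - segint (Q a) c d.

(** Each inner side is traversed twice, in opposite directions, and cancels. *)
Lemma circulation_quarter a m b c l d :
  a <= m -> m <= b -> b < X -> c <= l -> l <= d ->
  circulation a b c d = circulation a m c l + circulation m b c l +
    (circulation a m l d + circulation m b l d).
Proof.
move=> am mb bX cl ld; rewrite /circulation.
have HP y : segint (P ^~ y) a b = segint (P ^~ y) a m + segint (P ^~ y) m b.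
  apply: segint_split => // x; rewrite in_itv/= => /andP[_ xb].
  by apply: contP; exact: le_lt_trans bX.
have HQ x : x < X -> segint (Q x) c d = segint (Q x) c l + segint (Q x) l d.
  by move=> xX; apply: segint_split => // y _; exact: contQ.
rewrite !HP !HQ//; last by rewrite (le_lt_trans _ bX)// (le_trans am).
ring.
Qed.

(** To first order, P x c - P x d is beta (c - d) and Q b y - Q a y is beta (b - a). Integrated over
    the sides these contributions are opposite, so that only the error terms remain. *)
Lemma circulation_small x0 y0 : x0 < X -> forall e, 0 < e ->
  exists2 dl, 0 < dl & forall a b c d r, a <= x0 <= b -> c <= y0 <= d -> b < X ->
    b - a <= r -> d - c <= r -> r <= dl ->
    `|circulation a b c d| <= e * r * ((b - a) + (d - c)).
Proof.
move=> x0X e e0; have [beta Hb] := exPQ y0 x0X.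
have [dl dl0 H] := Hb _ e0; exists dl => // a b c d r /andP[ax xb] /andP[cy yd] bX.
move=> bar dcr rdl.
have aX : a < X by rewrite (le_lt_trans ax).
have ab : a <= b by exact: le_trans xb.
have cd : c <= d by exact: le_trans yd.
have inx x : x \in `[a, b] -> `|x - x0| <= r /\ x < X.
  rewrite in_itv/= => /andP[ax' xb']; rewrite (le_lt_trans xb')//; split=> //.
  by rewrite ler_norml; apply/andP; split; lra.
have iny y : y \in `[c, d] -> `|y - y0| <= r.
  by rewrite in_itv/= => /andP[? ?]; rewrite ler_norml; apply/andP; split; lra.
have ca : a \in `[a, b] by rewrite in_itv/= lexx.
have cb : b \in `[a, b] by rewrite in_itv/= lexx andbT.
have cc : c \in `[c, d] by rewrite in_itv/= lexx.
have cdd : d \in `[c, d] by rewrite in_itv/= lexx andbT.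
have Pc y x : x \in `[a, b] -> {for x, continuous (P ^~ y)}.
  by move=> /inx[_ xX]; exact: contP.
rewrite /circulation -segintB//; [|exact: Pc|exact: Pc].
rewrite -addrA -segintB//; [|by move=> *; exact: contQ|by move=> *; exact: contQ].
have HP : `|segint (fun x => P x c - P x d) a b - beta * (c - d) * (b - a)|
    <= e * r * (b - a).
  apply: segint_near_cst => // x xab; last first.
    by have [+ _] := H r x c d rdl (inx _ xab).1 (iny _ cc); apply; exact: iny.
  by apply: (@cvgB _ R^o); exact: Pc.
have HQ : `|segint (fun y => Q b y - Q a y) c d - beta * (b - a) * (d - c)|
    <= e * r * (d - c).
  apply: segint_near_cst => // y ycd; last first.
    by have [_] := H r b y a rdl (inx _ cb).1 (iny _ ycd); apply; exact: (inx _ ca).1.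
  by apply: (@cvgB _ R^o); exact: contQ.
rewrite mulrDr; move: (le_trans (ler_normD _ _) (lerD HP HQ)).
by congr (`|_| <= _); ring.
Qed.

(** A nonzero circulation would persist, in proportion to the area, in a sequence of nested
    quarters. These shrink to a point, where [circulation_small] gives a contradiction. *)
Lemma circulation_eq0 a b c d : a < b -> b < X -> c < d -> circulation a b c d = 0.
Proof.
move=> ab bX cd; apply/eqP/contraT => C0.
set w := b - a; set h := d - c.
have w0 : 0 < w by rewrite /w; lra.
have h0 : 0 < h by rewrite /h; lra.
(* Half of the initial modulus, so that the strict inequality in [S 0] holds at the start. *)
pose kap := `|circulation a b c d| / 2.
have kap0 : 0 < kap by rewrite divr_gt0 ?normr_gt0.
pose q (k : nat) : R := 2^-1 ^+ k.
have q0 k : 0 < q k by rewrite exprn_gt0// invr_gt0.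
have qS k : q k = q k.+1 + q k.+1 by rewrite /q exprS; field.
pose C k (p : R * R) := circulation p.1 (p.1 + w * q k) p.2 (p.2 + h * q k).
pose S k (p : R * R) := kap * q k ^+ 2 < `|C k p|.
pose sub k (p p' : R * R) :=
  [/\ p.1 <= p'.1, p.2 <= p'.2, p'.1 + w * q k.+1 <= p.1 + w * q k &
      p'.2 + h * q k.+1 <= p.2 + h * q k].
(* One of the four quarters keeps the circulation above [kap] times the area. *)
have step k p : p.1 + w * q k < X -> S k p -> exists p', sub k p p' /\ S k.+1 p'.
  case: p => x y /= xX Sk.
  have wq := mulr_gt0 w0 (q0 k.+1); have hq := mulr_gt0 h0 (q0 k.+1).
  apply: contrapT => /forallNP H.
  have HS x' y' : sub k (x, y) (x', y') -> `|C k.+1 (x', y')| <= kap * q k.+1 ^+ 2.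
    by move=> sb; rewrite leNgt; apply/negP => ?; apply: (H (x', y')).
  have E : C k (x, y) = C k.+1 (x, y) + C k.+1 (x + w * q k.+1, y) +
     (C k.+1 (x, y + h * q k.+1) + C k.+1 (x + w * q k.+1, y + h * q k.+1)).
    rewrite /C/= (@circulation_quarter _ (x + w * q k.+1) _ _ (y + h * q k.+1)).
    - rewrite !(qS k) !mulrDr !addrA.
    by [].
    - lra.
    - by rewrite (qS k); lra.
    - by [].
    - lra.
    - by rewrite (qS k); lra.
  have wS : x + w * q k.+1 + w * q k.+1 = x + w * q k by rewrite (qS k) mulrDr addrA.
  have hS : y + h * q k.+1 + h * q k.+1 = y + h * q k by rewrite (qS k) mulrDr addrA.
  have wl : x + w * q k.+1 <= x + w * q k by rewrite -wS lerDl ltW.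
  have hl : y + h * q k.+1 <= y + h * q k by rewrite -hS lerDl ltW.
  have xl : x <= x + w * q k.+1 by rewrite lerDl ltW.
  have yl : y <= y + h * q k.+1 by rewrite lerDl ltW.
  have s1 : sub k (x, y) (x, y) by split; rewrite /= ?lexx.
  have s2 : sub k (x, y) (x + w * q k.+1, y) by split; rewrite /= ?wS ?lexx.
  have s3 : sub k (x, y) (x, y + h * q k.+1) by split; rewrite /= ?hS ?lexx.
  have s4 : sub k (x, y) (x + w * q k.+1, y + h * q k.+1).
    by split; rewrite /= ?wS ?hS ?lexx.
  move: Sk; rewrite /S E ltNge => /negP; apply.
  have E2 : kap * q k ^+ 2 = kap * q k.+1 ^+ 2 + kap * q k.+1 ^+ 2 +
     (kap * q k.+1 ^+ 2 + kap * q k.+1 ^+ 2) by rewrite (qS k); ring.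
  rewrite E2; do 2 (apply: le_trans (ler_normD _ _) _; apply: lerD); exact: HS.
(* The level is an argument of the choice function, so the recursion carries only the lower left
   corner. Where the premises fail, the value [p] is a placeholder. *)
have [f Hf] : {f : nat * (R * R) -> R * R & forall kp, kp.2.1 + w * q kp.1 < X ->
    S kp.1 kp.2 -> sub kp.1 kp.2 (f kp) /\ S kp.1.+1 (f kp)}.
  apply: (@choice _ _ (fun kp p' => kp.2.1 + w * q kp.1 < X ->
    S kp.1 kp.2 -> sub kp.1 kp.2 p' /\ S kp.1.+1 p')) => -[k p] /=.
  have [xX|xX] := boolP (p.1 + w * q k < X); last by exists p.
  have [/(step _ _ xX)[p' ?]|?] := pselect (S k p); first by exists p'.
  by exists p.
pose p := nat_rect (fun=> (R * R)%type) (a, c) (fun k pk => f (k, pk)).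
have Hp k : [/\ p k.+1 = f (k, p k), (p k).1 + w * q k <= b & S k (p k)].
  elim: k => [|k [_ pb Sk]].
    split=> //; first by rewrite /p/= /q expr0 /w; lra.
    rewrite /S /C /= /q expr0 expr1n !mulr1 /w /h !subrKC /kap.
    by rewrite ltr_pdivrMr// ltr_pMr ?normr_gt0// ltr1n.
  have [|[? ? ? ?] ?] := Hf (k, p k) _ Sk; first exact: le_lt_trans bX.
  by split=> //; apply: le_trans pb.
have psub k : sub k (p k) (p k.+1).
  have [-> pb Sk] := Hp k.
  by have [|] := Hf (k, p k) _ Sk; first exact: le_lt_trans bX.
have psub1 j k : (j <= k)%N -> (p j).1 <= (p k).1 /\ (p k).1 + w * q k <= (p j).1 + w * q j.
  elim: k => [|k IH]; first by rewrite leqn0 => /eqP ->.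
  rewrite leq_eqVlt => /predU1P[->//|/IH[? ?]].
  by have [? _ ? _] := psub k; split; lra.
have psub2 j k : (j <= k)%N -> (p j).2 <= (p k).2 /\ (p k).2 + h * q k <= (p j).2 + h * q j.
  elim: k => [|k IH]; first by rewrite leqn0 => /eqP ->.
  rewrite leq_eqVlt => /predU1P[->//|/IH[? ?]].
  by have [_ ? _ ?] := psub k; split; lra.
(* Nested intervals meet: the supremum of the left endpoints lies in all of them. *)
have nest (u : nat -> R) (v : R) : 0 < v -> (forall j k, (j <= k)%N -> u j <= u k /\
    u k + v * q k <= u j + v * q j) -> exists z, forall k, u k <= z <= u k + v * q k.
  move=> v0 H; exists (sup (range u)) => k.
  have ub : ubound (range u) (u k + v * q k).
    move=> _ [j _ <-]; have [/H[_]|/ltnW/H[]] := leqP k j.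
      by apply: le_trans; rewrite lerDl mulr_ge0 ?ltW.
    by move=> /le_trans-> //; rewrite lerDl mulr_ge0 ?ltW.
  apply/andP; split; last by apply: ge_sup => //; exists (u 0); exists 0.
  by apply: ub_le_sup; [exists (u k + v * q k)|exists k].
have [x0 Hx] := nest _ _ w0 psub1.
have [y0 Hy] := nest _ _ h0 psub2.
have x0X : x0 < X.
  by have /andP[_] := Hx 0; have [_ + _] := Hp 0 => /[swap] /le_trans/[apply]/le_lt_trans; exact.
have wh : 0 < w + h by rewrite addr_gt0.
(* With r = (w + h) q k, this e makes the bound e r (w q k + h q k) equal to kap times the square of
   q k, which [S k] says is exceeded. *)
have [|dl dl0 Hs] := circulation_small y0 x0X (e := kap / (w + h) ^+ 2).
  by rewrite divr_gt0// exprn_gt0.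
have [k Hk] : exists k, (w + h) * q k < dl.
  have : q k @[k --> \oo] --> 0.
    by apply: cvg_expr; rewrite ger0_norm ?invr_ge0// invf_lt1// ltr1n.
  move=> /cvgrPdist_lt /(_ (dl / (w + h))) []; first by rewrite divr_gt0.
  move=> N _ /(_ N (leqnn _)) /=; rewrite sub0r normrN ger0_norm ?ltW//.
  by move=> H; exists N; rewrite mulrC -ltr_pdivlMr.
have [_ pb Sk] := Hp k.
have wq := mulr_gt0 w0 (q0 k); have hq := mulr_gt0 h0 (q0 k).
have := Hs (p k).1 ((p k).1 + w * q k) (p k).2 ((p k).2 + h * q k) ((w + h) * q k)
  (Hx k) (Hy k) (le_lt_trans pb bX).
have E1 : (p k).1 + w * q k - (p k).1 = w * q k by ring.
have E2 : (p k).2 + h * q k - (p k).2 = h * q k by ring.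
have wl : w * q k <= (w + h) * q k by rewrite ler_pM2r// lerDl ltW.
have hl : h * q k <= (w + h) * q k by rewrite ler_pM2r// lerDr ltW.
rewrite E1 E2 => /(_ wl hl (ltW Hk)).
have -> : kap / (w + h) ^+ 2 * ((w + h) * q k) * (w * q k + h * q k) =
    kap * q k ^+ 2 by field; rewrite gt_eqF.
by rewrite leNgt => /negP[].
Qed.

End Goursat.

(** * Complex differentiability *)

Section ComplexBasics.
Variable R : realType.
Implicit Types (z w : R[i]).

Lemma normcE z : `|z| = (normc z)%:C.
Proof. by case: z. Qed.

Lemma normc_ge0 z : 0 <= normc z.
Proof. by case: z => a b; exact: sqrtr_ge0. Qed.

Lemma normc_eq0 z : (normc z == 0) = (z == 0).
Proof. by apply/eqP/eqP => [/eq0_normc//|->]; exact: normc0. Qed.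

Lemma normc_gt0 z : (0 < normc z) = (z != 0).
Proof. by rewrite lt_neqAle eq_sym normc_eq0 normc_ge0 andbT. Qed.

Lemma normc_triangle z w : normc (z + w) <= normc z + normc w.
Proof. exact: le_normcD. Qed.

Lemma normc_opp z : normc (- z) = normc z.
Proof. exact: normcN. Qed.

Lemma normc_distC z w : normc (z - w) = normc (w - z).
Proof. by rewrite -normc_opp opprB. Qed.

Lemma normc_real (x : R) : normc x%:C = `|x|.
Proof. by rewrite /= expr0n addr0 sqrtr_sqr. Qed.

Lemma sqr_normcE z : normc z ^+ 2 = complex.Re z ^+ 2 + complex.Im z ^+ 2.
Proof. by case: z => a b /=; rewrite sqr_sqrtr// addr_ge0 ?sqr_ge0. Qed.

Lemma Re_le_normc z : `|complex.Re z| <= normc z.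
Proof.
by rewrite -(@ler_pXn2r _ 2) ?nnegrE ?normc_ge0// sqr_normcE real_normK ?num_real// lerDl sqr_ge0.
Qed.

Lemma Im_le_normc z : `|complex.Im z| <= normc z.
Proof.
by rewrite -(@ler_pXn2r _ 2) ?nnegrE ?normc_ge0// sqr_normcE real_normK ?num_real// lerDr sqr_ge0.
Qed.

Lemma normc_le_ReIm z : normc z <= `|complex.Re z| + `|complex.Im z|.
Proof.
have rI := num_real (complex.Im z); have rR := num_real (complex.Re z).
rewrite -(@ler_pXn2r _ 2) ?nnegrE ?normc_ge0 ?addr_ge0// sqr_normcE sqrrD.
by rewrite !real_normK// lerD2r lerDl mulrn_wge0// mulr_ge0.
Qed.

Lemma ReM z w : complex.Re (z * w) =
  complex.Re z * complex.Re w - complex.Im z * complex.Im w.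
Proof. by case: z w => [a b] [c d]. Qed.

Lemma ImM z w : complex.Im (z * w) =
  complex.Re z * complex.Im w + complex.Im z * complex.Re w.
Proof. by case: z w => [a b] [c d]. Qed.

Lemma ReD z w : complex.Re (z + w) = complex.Re z + complex.Re w.
Proof. by case: z w => [a b] [c d]. Qed.

Lemma ImD z w : complex.Im (z + w) = complex.Im z + complex.Im w.
Proof. by case: z w => [a b] [c d]. Qed.

Lemma ReN z : complex.Re (- z) = - complex.Re z.
Proof. by case: z. Qed.

Lemma ImN z : complex.Im (- z) = - complex.Im z.
Proof. by case: z. Qed.

Lemma complex_ext z w : complex.Re z = complex.Re w ->
  complex.Im z = complex.Im w -> z = w.
Proof. by case: z w => [a b] [c d] /= -> ->. Qed.

Lemma unit_diskE z : unit_disk z <-> normc z < 1.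
Proof. by rewrite /unit_disk/= normcE -[X in _ < X]/(1%:C) ltcR. Qed.

Lemma unit_circleE z : unit_circle z <-> normc z = 1.
Proof. by rewrite /unit_circle/= normcE; split => [[]|->]. Qed.

(** Differentiability with derivative [A], without quotients and with real epsilons: [normc] takes
    its values in R, where the estimates are carried out. *)
Definition cdiff (f : R[i] -> R[i]) z (A : R[i]) := forall e, 0 < e ->
  exists2 d, 0 < d & forall w, normc (w - z) < d ->
    normc (f w - f z - A * (w - z)) <= e * normc (w - z).

Definition ccont (f : R[i] -> R[i]) z := forall e, 0 < e ->
  exists2 d, 0 < d & forall w, normc (w - z) < d -> normc (f w - f z) <= e.

Lemma cdiff_cont f z A : cdiff f z A -> ccont f z.
Proof.
move=> H e e0; have [d d0 Hd] := H 1 ltr01.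
have k0 : 0 < 1 + normc A by rewrite ltr_pwDl// normc_ge0.
exists (Num.min d (e / (1 + normc A))); first by rewrite lt_min d0 divr_gt0.
move=> w; rewrite lt_min => /andP[/Hd wd]; rewrite ltr_pdivlMr// => we.
have -> : f w - f z = (f w - f z - A * (w - z)) + A * (w - z) by ring.
apply: le_trans (normc_triangle _ _) _; rewrite normcM.
by move: wd we; lra.
Qed.

Lemma cdiff_ext f g z A d : 0 < d ->
  (forall w, normc (w - z) < d -> f w = g w) -> cdiff f z A -> cdiff g z A.
Proof.
move=> d0 fg H e /H[d' d'0 {}H]; exists (Num.min d d').
  by rewrite lt_min d0.
move=> w; rewrite lt_min => /andP[wd wd']; rewrite -!fg ?subrr ?normc0//.
exact: H.
Qed.

Lemma cdiff_comp f g z A B : cdiff f z A -> cdiff g (f z) B ->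
  cdiff (g \o f) z (B * A).
Proof.
move=> Hf Hg e e0.
have a0 := normc_ge0 A; have b0 := normc_ge0 B.
(* The two errors add up to (e1 (e1 + |A|) + |B| e1) |w - z|, at most e1 k |w - z| because e1 <=
   1. *)
pose k := 1 + normc A + normc B.
have k0 : 0 < k by rewrite /k; lra.
have ek0 : 0 < Num.min 1 (e / k) by rewrite lt_min ltr01 divr_gt0.
set e1 := Num.min 1 (e / k) in ek0.
have e11 : e1 <= 1 by rewrite /e1 ge_min lexx.
have e1k : e1 * k <= e by rewrite -ler_pdivlMr// /e1 ge_min lexx orbT.
have [d1 d10 H1] := Hf _ ek0; have [d2 d20 H2] := Hg _ ek0.
have [d3 d30 H3] := cdiff_cont Hf (e := d2 / 2) ltac:(lra).
exists (Num.min d1 d3); first by rewrite lt_min d10.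
move=> w; rewrite lt_min => /andP[/H1 wd1 /H3 wd3] /=.
have /H2 {}H2 : normc (f w - f z) < d2 by lra.
set x := normc (w - z) in wd1 *.
have x0 : 0 <= x by exact: normc_ge0.
have fx : normc (f w - f z) <= (e1 + normc A) * x.
  have -> : f w - f z = (f w - f z - A * (w - z)) + A * (w - z) by ring.
  by apply: le_trans (normc_triangle _ _) _; rewrite normcM mulrDl lerD2r.
have -> : g (f w) - g (f z) - B * A * (w - z) =
  (g (f w) - g (f z) - B * (f w - f z)) + B * (f w - f z - A * (w - z)) by ring.
apply: le_trans (normc_triangle _ _) _; rewrite normcM.
have : normc B * normc (f w - f z - A * (w - z)) <= normc B * (e1 * x).
  by rewrite ler_wpM2l.
have : e1 * normc (f w - f z) <= e1 * ((e1 + normc A) * x).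
  by rewrite ler_pM2l.
have : e1 * (e1 * x) <= e1 * (1 * x) by rewrite ler_pM2l// ler_wpM2r.
have : e1 * k * x <= e * x by rewrite ler_wpM2r.
by rewrite /k; lra.
Qed.

Lemma cdiff_affine a b z : cdiff (fun w => a + b * w) z b.
Proof.
move=> e e0; exists 1 => // w _.
have -> : a + b * w - (a + b * z) - b * (w - z) = 0 by ring.
by rewrite normc0 mulr_ge0 ?normc_ge0 ?ltW.
Qed.

Lemma cdiffD f g z A B : cdiff f z A -> cdiff g z B ->
  cdiff (fun w => f w + g w) z (A + B).
Proof.
move=> Hf Hg e e0; have e20 : 0 < e / 2 by lra.
have [d1 d10 H1] := Hf _ e20; have [d2 d20 H2] := Hg _ e20.
exists (Num.min d1 d2); first by rewrite lt_min d10.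
move=> w; rewrite lt_min => /andP[/H1 h1 /H2 h2].
have -> : f w + g w - (f z + g z) - (A + B) * (w - z) =
  (f w - f z - A * (w - z)) + (g w - g z - B * (w - z)) by ring.
by apply: le_trans (normc_triangle _ _) _; lra.
Qed.

Lemma ccontD f g z : ccont f z -> ccont g z -> ccont (fun w => f w + g w) z.
Proof.
move=> Hf Hg e e0; have e20 : 0 < e / 2 by lra.
have [d1 d10 H1] := Hf _ e20; have [d2 d20 H2] := Hg _ e20.
exists (Num.min d1 d2); first by rewrite lt_min d10.
move=> w; rewrite lt_min => /andP[/H1 h1 /H2 h2].
rewrite (_ : _ - _ = (f w - f z) + (g w - g z)); last by ring.
by apply: le_trans (normc_triangle _ _) _; lra.
Qed.

Lemma ccont_scale c f z : ccont f z -> ccont (fun w => c * f w) z.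
Proof.
move=> H e e0; have c0 := normc_ge0 c.
have k0 : 0 < 1 + normc c by lra.
have [|d d0 Hd] := H (e / (1 + normc c)); first by rewrite divr_gt0.
exists d => // w /Hd; rewrite ler_pdivlMr// -mulrBr normcM.
by have := normc_ge0 (f w - f z); nra.
Qed.

End ComplexBasics.

Section FirstOrder.

(** Multiplying the difference quotient by h removes the division. A general [numFieldType] lets the
    estimate serve for both R and R[i]. *)
Lemma first_order (K : numFieldType) (f : K -> K^o) (x : K) : derivable f x 1 ->
  forall e : K, 0 < e -> exists2 d : K, 0 < d &
    forall h, `|h| < d -> `|f (h + x) - f x - 'D_1 f x * h| <= e * `|h|.
Proof.
move=> fx e e0; have /cvgrPdist_le/(_ e e0) := fx.
case => d /= d0 H; exists d => // h hd.
have [->|h0] := eqVneq h 0; first by rewrite add0r subrr mulr0 subrr normr0 mulr0.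
have := H h; rewrite /= sub0r normrN => /(_ hd h0).
rewrite -[h *: 1]/(h * 1) mulr1 => He.
have -> : f (h + x) - f x - 'D_1 f x * h =
  - h * ('D_1 f x - h^-1 *: (f (h + x) - f x)).
  rewrite -[_ *: _]/(h^-1 * (f (h + x) - f x)) mulrBr !mulNr mulVKf// opprK.
  by rewrite addrC mulrC.
by rewrite normrM normrN mulrC ler_wpM2r//.
Qed.

End FirstOrder.

Section Derivative.
Variable R : realType.

Lemma derivable_cdiff (f : R[i] -> R[i]) z : derivable f z 1 -> cdiff f z (derive1 f z).
Proof.
move=> /(@first_order R[i] f) H e e0.
have [|d d0 Hd] := H e%:C; first by rewrite ltcR.
(* A positive element of R[i] is real. *)
have dE : d = (complex.Re d)%:C.
  by apply/complex_ext => //=; move: d0; rewrite ltcE/= => /andP[/eqP->].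
exists (complex.Re d); first by rewrite -ltcR -dE.
move=> w wd; have := Hd (w - z); rewrite subrK normcE dE ltcR => /(_ wd).
by rewrite derive1E !normcE -rmorphM lecR.
Qed.

End Derivative.

(** * Mean value property *)

Section ComplexExponential.
Variable R : realType.
Implicit Types (z w : R[i]).

Lemma real_first_order (f : R -> R) (x A : R) : is_derive x 1 f A ->
  forall e, 0 < e -> exists2 d, 0 < d &
    forall h, `|h| < d -> `|f (h + x) - f x - A * h| <= e * `|h|.
Proof. by case=> /(@first_order R f) + <-. Qed.

Lemma cexp0 : cexp (0 : R[i]) = 1.
Proof. by apply: complex_ext; rewrite /= expR0 ?cos0 ?sin0 ?mul1r. Qed.

Lemma cexpD z w : cexp (z + w) = cexp z * cexp w.
Proof.
by case: z w => [a b] [c d]; apply: complex_ext; rewrite /= expRD ?cosD ?sinD; ring.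
Qed.

Lemma normc_cexp z : normc (cexp z) = expR (complex.Re z).
Proof.
rewrite /= !exprMn -mulrDr cos2Dsin2 mulr1 sqrtr_sqr ger0_norm//; exact: expR_ge0.
Qed.

(** The real expansions of exp, cos and sin at 0 are combined; the addition formula later carries
    the result to any point. *)
Lemma cdiff_cexp0 : cdiff (@cexp R) 0 1.
Proof.
(* The real and imaginary parts each have error at most 3 k x, hence the factor 6. The radius k / 2
   absorbs the quadratic term 2 x x into k x. *)
move=> e e0; have e6 : 0 < Num.min (e / 6) 1 by rewrite lt_min ltr01 andbT divr_gt0.
set k := Num.min (e / 6) 1 in e6.
have ke : 6 * k <= e.
  have : k <= e / 6 by rewrite /k ge_min lexx.
  by lra.
have k1 : k <= 1 by rewrite /k ge_min lexx orbT.
have [d1 d10 H1] := real_first_order (is_derive_expR 0) e6.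
have [d2 d20 H2] := real_first_order (is_derive_cos 0) e6.
have [d3 d30 H3] := real_first_order (is_derive_sin 0) e6.
pose d := Num.min (Num.min d1 d2) (Num.min d3 (k / 2)).
have k2 : 0 < k / 2 by rewrite divr_gt0.
exists d; first by rewrite !lt_min d10 d20 d30 k2.
move=> w; rewrite subr0; set x := normc w; rewrite !lt_min => /andP[/andP[x1 x2] /andP[x3 x4]].
have ax : `|complex.Re w| <= x by exact: Re_le_normc.
have bx : `|complex.Im w| <= x by exact: Im_le_normc.
have {H1} := H1 (complex.Re w) (le_lt_trans ax x1).
have {H2} := H2 (complex.Im w) (le_lt_trans bx x2).
have {H3} := H3 (complex.Im w) (le_lt_trans bx x3).
rewrite !addr0 expR0 cos0 sin0 oppr0 mul0r !mul1r !subr0 !addr0 cexp0.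
set a := complex.Re w in ax *; set b := complex.Im w in bx *.
move=> sb cb ea.
have kx y : y <= x -> k * y <= k * x by move=> ?; rewrite ler_pM2l.
have {}sb : `|sin b - b| <= k * x by exact: le_trans sb (kx _ bx).
have {}cb : `|cos b - 1| <= k * x by exact: le_trans cb (kx _ bx).
have {}ea : `|expR a - 1 - a| <= k * x by exact: le_trans ea (kx _ ax).
have x0 : 0 <= x by exact: normc_ge0.
have kxx : k * x <= x by rewrite -[leRHS]mul1r ler_wpM2r.
have e1 : `|expR a - 1| <= 2 * x.
  rewrite (_ : _ - 1 = expR a - 1 - a + a); last by ring.
  by apply: le_trans (ler_normD _ _) _; lra.
have e2 : expR a <= 2 by move: e1; rewrite ler_norml => /andP[_]; lra.
have eg := expR_gt0 a.
have xk : 2 * x * x <= k * x by rewrite ler_wpM2r//; lra.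
apply: le_trans (normc_le_ReIm _) _.
have -> : complex.Re (cexp w - 1 - w) = expR a * (cos b - 1) + (expR a - 1 - a).
  by rewrite /a /b; case: (w) => u v /=; ring.
have -> : complex.Im (cexp w - 1 - w) = expR a * (sin b - b) + (expR a - 1) * b.
  by rewrite /a /b; case: (w) => u v /=; ring.
have t1 := ler_normD (expR a * (cos b - 1)) (expR a - 1 - a).
have t2 := ler_normD (expR a * (sin b - b)) ((expR a - 1) * b).
rewrite !normrM (ger0_norm (ltW eg)) in t1 t2.
have u1 : expR a * `|cos b - 1| <= 2 * (k * x).
  by apply: ler_pM => //; exact: ltW.
have u2 : expR a * `|sin b - b| <= 2 * (k * x).
  by apply: ler_pM => //; exact: ltW.
have u3 : `|expR a - 1| * `|b| <= 2 * x * x by apply: ler_pM.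
have : 6 * k * x <= e * x by rewrite ler_wpM2r.
by lra.
Qed.

Lemma cdiff_cexp z : cdiff (@cexp R) z (cexp z).
Proof.
move=> e e0; have g0 := expR_gt0 (complex.Re z).
have [|d d0 H] := cdiff_cexp0 (e := e / expR (complex.Re z)).
  by rewrite divr_gt0.
exists d => // w wd; have := H (w - z); rewrite subr0 cexp0 => /(_ wd).
rewrite mulrAC ler_pdivlMr// -normc_cexp mulrC -normcM => Hw.
suff -> : cexp w - cexp z - cexp z * (w - z) =
    cexp z * (cexp (w - z) - 1 - 1 * (w - z)) by [].
by have -> : cexp w = cexp z * cexp (w - z); [rewrite -cexpD subrKC|ring].
Qed.

Lemma cexp_2pi z : cexp (complex.Re z +i* (complex.Im z + pi *+ 2)) = cexp z.
Proof. by case: z => a b; rewrite /cexp/= cosD2pi sinD2pi. Qed.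

End ComplexExponential.

(** * Restrictions to coordinate lines and the Cauchy-Riemann equation *)

Section Slices.
Variable R : realType.

Lemma ccont_Re_h (f : R[i] -> R[i]) x y : ccont f (x +i* y) ->
  {for x, continuous (fun t => complex.Re (f (t +i* y)))} /\
  {for x, continuous (fun t => complex.Im (f (t +i* y)))}.
Proof.
move=> H; split; apply/cvgrPdist_le => e /H[d d0 Hd]; near=> t;
  apply: le_trans (Hd (t +i* y) _).
- by rewrite normc_distC -ReN -ReD; exact: Re_le_normc.
- by near: t; exists d => // t xt; rewrite normc_distC /= subrr expr0n addr0 sqrtr_sqr.
- by rewrite normc_distC -ImN -ImD; exact: Im_le_normc.
- by near: t; exists d => // t xt; rewrite normc_distC /= subrr expr0n addr0 sqrtr_sqr.
Unshelve. all: by end_near. Qed.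

Lemma ccont_Re_v (f : R[i] -> R[i]) x y : ccont f (x +i* y) ->
  {for y, continuous (fun t => complex.Re (f (x +i* t)))}.
Proof.
move=> H; apply/cvgrPdist_le => e /H[d d0 Hd]; near=> t.
apply: le_trans (Hd (x +i* t) _).
  by rewrite normc_distC -ReN -ReD; exact: Re_le_normc.
by near: t; exists d => // t xt; rewrite normc_distC /= subrr expr0n add0r sqrtr_sqr.
Unshelve. all: by end_near. Qed.

(** The form Im f dx + Re f dy is the imaginary part of f dz. Its closedness is one of the
    Cauchy-Riemann equations, with common value Re A. *)
Lemma cdiff_exact (f : R[i] -> R[i]) x0 y0 A : cdiff f (x0 +i* y0) A ->
  exact_at (fun x y => complex.Im (f (x +i* y)))
           (fun x y => complex.Re (f (x +i* y))) x0 y0.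
Proof.
move=> H; exists (complex.Re A) => e e0.
(* Points whose coordinates are off by at most r lie within 2 r of the center, so each costs e r / 2
   and a difference of two costs e r. The bound r <= d / 3 keeps 2 r below d. *)
have [|d d0 Hd] := H (e / 4); first by lra.
exists (d / 3); first by lra.
move=> r x y t rd xr yr.
have Hr u v : `|u - x0| <= r -> `|v - y0| <= r ->
    normc (f (u +i* v) - f (x0 +i* y0) - A * ((u - x0) +i* (v - y0))) <= e * r / 2.
  move=> ur vr; have r0 : 0 <= r by exact: le_trans ur.
  have nr : normc ((u - x0) +i* (v - y0)) <= 2 * r.
    by apply: le_trans (normc_le_ReIm _) _; rewrite /=; lra.
  have := Hd (u +i* v) ltac:(rewrite /= in nr *; lra).
  move/le_trans; apply.
  have : e / 4 * normc ((u - x0) +i* (v - y0)) <= e / 4 * (2 * r).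
    by rewrite ler_pM2l//; lra.
  by move=> /= ?; lra.
have Hdiff u v u' v' : `|u - x0| <= r -> `|v - y0| <= r -> `|u' - x0| <= r ->
    `|v' - y0| <= r -> normc (f (u +i* v) - f (u' +i* v') -
      A * ((u - u') +i* (v - v'))) <= e * r.
  move=> ur vr ur' vr'; have h1 := Hr _ _ ur vr; have h2 := Hr _ _ ur' vr'.
  rewrite (_ : _ - _ = (f (u +i* v) - f (x0 +i* y0) - A * ((u - x0) +i* (v - y0))) +
    - (f (u' +i* v') - f (x0 +i* y0) - A * ((u' - x0) +i* (v' - y0)))).
    by apply: le_trans (normc_triangle _ _) _; rewrite normc_opp; lra.
  have -> : (u - u') +i* (v - v') = ((u - x0) +i* (v - y0)) - ((u' - x0) +i* (v' - y0)).
    by apply: complex_ext => /=; ring.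
  by ring.
split=> tr.
- apply: le_trans (Hdiff x y x t xr yr xr tr).
  apply: le_trans (Im_le_normc _).
  by rewrite !ImD !ImN ImM/= subrr mulr0 addr0.
- apply: le_trans (Hdiff x y t y xr yr tr yr).
  apply: le_trans (Re_le_normc _).
  by rewrite !ReD !ReN ReM/= subrr mulr0 subr0.
Qed.

End Slices.

Section MeanValue.
Variables (R : realType) (G : R[i] -> R[i]) (z1 : R[i]) (rho : R).
Hypothesis rho0 : 0 < rho.
Hypothesis dG : forall z, 0 < normc (z - z1) < rho -> exists A, cdiff G z A.
Hypothesis cG : ccont G z1.

(** The logarithmic coordinate: the circle of radius exp x around [z1] becomes the vertical line of
    abscissa x, and the punctured disk becomes a half-plane. *)
Let F (z : R[i]) := G (z1 + cexp z).

Lemma cdiff_polar z : complex.Re z < ln rho -> exists A, cdiff F z A.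
Proof.
move=> zr; have [|A HA] := dG (z := z1 + cexp z).
  by rewrite addrC addKr normc_cexp expR_gt0/= -ltr_ln ?posrE ?expR_gt0// expRK.
exists (A * (1 * cexp z)); apply: (cdiff_comp (f := fun w => z1 + cexp w)) => //.
apply: (cdiff_comp (f := @cexp R) (g := fun w => z1 + w)); first exact: cdiff_cexp.
apply: cdiff_ext ltr01 _ (cdiff_affine z1 1 _) => w _; by rewrite mul1r.
Qed.

(** Goursat on [a, b] x [0, 2 pi]: the horizontal sides cancel by periodicity of [cexp], so the
    vertical ones agree. *)
Lemma circle_mean_cst (a b : R) : a < b -> b < ln rho ->
  segint (fun y => complex.Re (F (a +i* y))) 0 (pi *+ 2) =
  segint (fun y => complex.Re (F (b +i* y))) 0 (pi *+ 2).
Proof.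
move=> ab br.
have cF x y : x < ln rho -> ccont F (x +i* y).
  by move=> xr; have [|A /cdiff_cont] := @cdiff_polar (x +i* y).
have : circulation (fun x y => complex.Im (F (x +i* y)))
    (fun x y => complex.Re (F (x +i* y))) a b 0 (pi *+ 2) = 0.
  apply: (@circulation_eq0 _ _ _ (ln rho)) => //.
  - by move=> x y xr; have [|A] := @cdiff_polar (x +i* y) => // /cdiff_exact.
  - by move=> x y /(cF x y)/ccont_Re_h[].
  - by move=> x y /(cF x y)/ccont_Re_v.
  - by rewrite mulrn_wgt0// pi_gt0.
rewrite /circulation.
have -> : (fun x => complex.Im (F (x +i* 0))) =
    (fun x => complex.Im (F (x +i* (pi *+ 2)))).
  by apply/funext => x; have := cexp_2pi (x +i* 0); rewrite /F /= add0r => ->.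
move: (segint (fun x => complex.Im _) a b)
  (segint (fun y => complex.Re (F (a +i* y))) _ _)
  (segint (fun y => complex.Re (F (b +i* y))) _ _) => u va vb; lra.
Qed.

(** The mean does not depend on the radius, and continuity at [z1] identifies its limit as the
    radius tends to 0. *)
Lemma circle_mean (r : R) : 0 < r < rho ->
  segint (fun y => complex.Re (F (ln r +i* y))) 0 (pi *+ 2) =
  complex.Re (G z1) * (pi *+ 2).
Proof.
move=> /andP[r0 rr].
have pi0 : 0 < pi *+ 2 :> R by rewrite mulrn_wgt0// pi_gt0.
have lr : ln r < ln rho by rewrite ltr_ln ?posrE.
apply/eqP; rewrite -subr_eq0 -normr_le0; apply/ler_addgt0Pr => e e0.
rewrite add0r.
have [|d d0 Hd] := cG (e := e / (pi *+ 2)); first by rewrite divr_gt0.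
(* The radius exp a is below both r and the continuity threshold d. *)
pose a := Num.min (ln r - 1) (ln (d / 2)).
have ar : a < ln r.
  by have : a <= ln r - 1 by [rewrite /a ge_min lexx]; lra.
have ad : expR a < d.
  have : expR a <= d / 2.
    rewrite -[leRHS]lnK ?posrE; last by lra.
    by rewrite ler_expR /a ge_min lexx orbT.
  by lra.
rewrite -(circle_mean_cst ar lr) -[X in _ * X]subr0.
have -> : e = e / (pi *+ 2) * (pi *+ 2 - 0) by rewrite subr0 mulfVK// gt_eqF.
apply: segint_near_cst; first exact: ltW.
  move=> y _; apply: ccont_Re_v; have [|A /cdiff_cont//] := @cdiff_polar (a +i* y).
  exact: lt_trans lr.
move=> y _; rewrite -ReN -ReD; apply: le_trans (Re_le_normc _) _.
by apply: Hd; rewrite addrC addKr normc_cexp.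
Qed.

Lemma circle_mean_le (r K : R) : 0 < r < rho ->
  (forall w, normc (w - z1) = r -> complex.Re (G w) <= K) -> complex.Re (G z1) <= K.
Proof.
move=> /[dup] /andP[r0 rr] /circle_mean E HK.
have pi0 : 0 < pi *+ 2 :> R by rewrite mulrn_wgt0// pi_gt0.
rewrite -(ler_pM2r pi0) -E -[X in _ <= _ * X]subr0 -segint_cst; last exact: ltW.
apply: segint_le => [y _|y _|y _].
- apply: ccont_Re_v; have [|A /cdiff_cont//] := @cdiff_polar (ln r +i* y).
  by rewrite ltr_ln ?posrE.
- exact: cvg_cst.
- by apply: HK; rewrite addrC addKr normc_cexp/= lnK ?posrE.
Qed.

End MeanValue.

Section MeanValueEq.
Variables (R : realType) (G : R[i] -> R[i]) (z1 : R[i]) (rho : R).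
Hypothesis rho0 : 0 < rho.
Hypothesis dG : forall z, 0 < normc (z - z1) < rho -> exists A, cdiff G z A.
Hypothesis cG : ccont G z1.

(** If Re G w were less than K, continuity would leave a deficit on an arc next to w, and the mean
    would fall below K. *)
Lemma circle_mean_eq (r K : R) : 0 < r < rho ->
  (forall w, normc (w - z1) = r -> complex.Re (G w) <= K) -> complex.Re (G z1) = K ->
  forall w, normc (w - z1) = r -> complex.Re (G w) = K.
Proof.
move=> /[dup] rr /andP[r0 rrho] HK GK w wr.
(* Rotating about [z1] by [lam] puts w at angle 0, the left end of the interval of integration. *)
pose lam := (w - z1) / r%:C.
have rC0 : r%:C != 0 :> R[i] by rewrite eq_complex/= eqxx andbT gt_eqF.
have lam1 : normc lam = 1.
  by rewrite /lam normcM normcV wr normc_real gtr0_norm// divff// gt_eqF.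
pose H z := G (z1 - lam * z1 + lam * z).
have Hz z : z1 - lam * z1 + lam * z - z1 = lam * (z - z1) by ring.
have nz z : normc (z1 - lam * z1 + lam * z - z1) = normc (z - z1).
  by rewrite Hz normcM lam1 mul1r.
have dH z : 0 < normc (z - z1) < rho -> exists A, cdiff H z A.
  rewrite -nz => /dG[A HA]; exists (A * lam).
  exact: (cdiff_comp (cdiff_affine (z1 - lam * z1) lam z)).
have H1 : H z1 = G z1 by rewrite /H subrK.
have cH : ccont H z1.
  by move=> e /cG[d d0 Hd]; exists d => // z zd; rewrite H1; apply: Hd; rewrite nz.
have := circle_mean rho0 dH cH rr; rewrite H1 GK.
set f := (fun y => _) => fK.
have fle y : f y <= K.
  by apply: HK; rewrite nz addrC addKr normc_cexp/= lnK ?posrE.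
have fc y : {for y, continuous f}.
  apply: (@ccont_Re_v _ (fun z => H (z1 + cexp z))).
  have [|A /cdiff_cont//] := @cdiff_polar _ _ _ _ rho0 dH (ln r +i* y).
  by rewrite /= ltr_ln ?posrE.
have f0 : f 0 = complex.Re (G w).
  rewrite /f /H; congr (complex.Re (G _)).
  have -> : cexp (ln r +i* 0) = r%:C.
    by apply: complex_ext; rewrite /= lnK ?posrE// ?cos0 ?sin0 ?mulr1 ?mulr0.
  rewrite /lam; have -> : z1 - (w - z1) / r%:C * z1 + (w - z1) / r%:C * (z1 + r%:C) =
    z1 + (w - z1) / r%:C * r%:C by ring.
  by rewrite mulfVK// subrKC.
rewrite -f0; apply/eqP; rewrite eq_le fle leNgt; apply/negP => fK0.
have pi0 : 0 < pi *+ 2 :> R by rewrite mulrn_wgt0// pi_gt0.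
(* Half of the deficit at angle 0, so that f is at most K - dl on a short interval [0, eta]. *)
have := fc 0; pose dl := (K - f 0) / 2.
have dl0 : 0 < dl by rewrite /dl; lra.
move=> /cvgrPdist_le/(_ dl dl0)[e /= e0 He].
pose eta := Num.min (e / 2) (pi *+ 2).
have eta0 : 0 < eta by rewrite lt_min pi0 divr_gt0.
have etapi : eta <= pi *+ 2 by rewrite ge_min lexx orbT.
have etae : eta < e by have : eta <= e / 2 by [rewrite ge_min lexx]; lra.
move: fK; rewrite (@segint_split _ _ _ eta)//; last exact: ltW.
have : segint f 0 eta <= segint (fun=> K - dl) 0 eta.
  apply: segint_le => // [y _|y]; first exact: cvg_cst.
  rewrite in_itv/= => /andP[y0 ye]; have := He y; rewrite /= sub0r normrN ger0_norm//.
  by move=> /(_ (le_lt_trans ye etae)); rewrite ler_norml /dl => /andP[]; lra.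
have : segint f eta (pi *+ 2) <= segint (fun=> K) eta (pi *+ 2).
  by apply: segint_le => // y _; exact: cvg_cst.
rewrite !segint_cst ?(ltW eta0)// => h1 h2 h3.
have := mulr_gt0 dl0 eta0; lra.
Qed.

End MeanValueEq.

Local Arguments normc : simpl never.

(** * Maximum principle and Schwarz lemma *)

Section ClosedDisk.
Variable R : realType.

Lemma near_pair (p : R * R) (d : R) : 0 < d ->
  \forall t \near p, normc ((t.1 +i* t.2) - (p.1 +i* p.2)) < d.
Proof.
move=> d0; have d2 : 0 < d / 2 by rewrite divr_gt0.
have /cvgrPdist_lt/(_ _ d2) h1 : {for p, continuous (@fst R R)} by exact: cvg_fst.
have /cvgrPdist_lt/(_ _ d2) h2 : {for p, continuous (@snd R R)} by exact: cvg_snd.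
near=> t.
have k1 : `|p.1 - t.1| < d / 2 by near: t.
have k2 : `|p.2 - t.2| < d / 2 by near: t.
rewrite normc_distC; apply: le_lt_trans (normc_le_ReIm _) _ => /=; lra.
Unshelve. all: by end_near. Qed.

Lemma normc_pair_continuous : continuous (fun p : R * R => normc (p.1 +i* p.2)).
Proof.
move=> p; apply/cvgrPdist_lt => e e0; near=> t.
have : normc ((t.1 +i* t.2) - (p.1 +i* p.2)) < e by near: t; exact: near_pair.
have := normc_triangle ((t.1 +i* t.2) - (p.1 +i* p.2)) (p.1 +i* p.2).
have := normc_triangle ((p.1 +i* p.2) - (t.1 +i* t.2)) (t.1 +i* t.2).
by rewrite !subrK normc_distC => h1 h2 h3; rewrite ltr_norml; apply/andP; split; lra.
Unshelve. all: by end_near. Qed.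

Lemma closed_disk_compact (r : R) : compact [set p : R * R | normc (p.1 +i* p.2) <= r].
Proof.
apply: (@subclosed_compact _ _ (`[- r, r] `*` `[- r, r])).
- apply: (@closed_comp _ _ (fun p : R * R => normc (p.1 +i* p.2)) [set x | x <= r]).
    by move=> p _; exact: normc_pair_continuous.
  exact: closed_le.
- by apply: compact_setX; exact: segment_compact.
- move=> [x y] /= xyr; rewrite /= !in_itv/= -!ler_norml; split.
    exact: le_trans (Re_le_normc (x +i* y)) xyr.
  exact: le_trans (Im_le_normc (x +i* y)) xyr.
Qed.

End ClosedDisk.

Section MaximumPrinciple.
Variables (R : realType) (g : R[i] -> R[i]).
Hypothesis dg : forall z, 0 < normc z < 1 -> exists A, cdiff g z A.
Hypothesis cg : forall z, normc z < 1 -> ccont g z.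

(* A small multiple of |z|^2 makes the real part strictly subharmonic, so that
   it has no interior maximum. *)
Lemma max_principle (r M : R) : 0 < r < 1 ->
  (forall w, normc w = r -> complex.Re (g w) <= M) ->
  forall w, normc w <= r -> complex.Re (g w) <= M.
Proof.
move=> /andP[r0 r1] HM w0 w0r; rewrite leNgt; apply/negP => MW.
(* Then e r^2 is half of the excess of Re g w0 over M, and a maximizer of [v] cannot lie on the
   circle of radius r. *)
pose e := (complex.Re (g w0) - M) / (2 * r ^+ 2).
have r20 : 0 < r ^+ 2 by rewrite exprn_gt0.
have e0 : 0 < e by rewrite divr_gt0 ?subr_gt0 ?mulr_gt0.
have er : e * r ^+ 2 < complex.Re (g w0) - M.
  have -> : e * r ^+ 2 = (complex.Re (g w0) - M) / 2 by rewrite /e; field; rewrite gt_eqF.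
  by lra.
pose v (p : R * R) := complex.Re (g (p.1 +i* p.2)) + e * (normc (p.1 +i* p.2)) ^+ 2.
have [||[x y] + vmax] := compact_EVT_max (f := v) _ (@closed_disk_compact R r).
- by exists (complex.Re w0, complex.Im w0) => /=; move: w0r; case: (w0).
- apply: continuous_in_subspaceT => p /set_mem pr.
  have nc := @normc_pair_continuous R p.
  apply: (@cvgD _ R^o).
    apply/cvgrPdist_le => k /(cg (le_lt_trans pr r1))[d d0 Hd]; near=> t.
    have /Hd : normc ((t.1 +i* t.2) - (p.1 +i* p.2)) < d by near: t; exact: near_pair.
    by apply: le_trans; rewrite normc_distC -ReN -ReD; exact: Re_le_normc.
  by apply: cvgM; [exact: cvg_cst|apply: cvgM].
rewrite inE /=; set z1 := x +i* y => z1r.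
have {}vmax z : normc z <= r ->
    complex.Re (g z) + e * normc z ^+ 2 <= complex.Re (g z1) + e * normc z1 ^+ 2.
  by case: z => a b abr; have := vmax (a, b); rewrite inE /v/=; apply.
have z1lt : normc z1 < r.
  rewrite lt_neqAle z1r andbT; apply/eqP => z1E.
  have := HM _ z1E; have := vmax _ w0r; rewrite z1E.
  have : 0 <= e * normc w0 ^+ 2 by rewrite mulr_ge0 ?sqr_ge0// ltW.
  lra.
have z10 := normc_ge0 z1.
(* The punctured disk around [z1] must avoid 0, where [g] is only assumed continuous, and stay
   within radius r. *)
pose rho := if z1 == 0 then r else Num.min (normc z1) (r - normc z1).
have rho0 : 0 < rho.
  by rewrite /rho; case: eqP => // /eqP z0; rewrite lt_min normc_gt0 z0/= subr_gt0.
have rhor : normc z1 + rho <= r.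
  rewrite /rho; case: eqP => [->|_]; first by rewrite normc0 add0r.
  have : Num.min (normc z1) (r - normc z1) <= r - normc z1 by rewrite ge_min lexx orbT.
  by lra.
(* The linear term of e |z|^2 at [z1] is the real part of an affine holomorphic function. Once it is
   added, Re G is the maximized quantity plus a constant minus e |z - z1|^2, so its mean on a circle
   around [z1] is too small. *)
pose G z := g z + (2 * e)%:C * z1^* * (z - z1).
have GE z : complex.Re (G z) =
    complex.Re (g z) + e * (normc z ^+ 2 - normc z1 ^+ 2 - normc (z - z1) ^+ 2).
  rewrite /G ReD; congr (_ + _); rewrite !sqr_normcE /z1; case: z => a b /=; ring.
have zdisk z : normc (z - z1) < rho -> normc z < r.
  move=> zr; have := normc_triangle (z - z1) z1; rewrite subrK; lra.
have dG z : 0 < normc (z - z1) < rho -> exists A, cdiff G z A.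
  move=> /andP[zz zr]; have zlt := zdisk _ zr.
  have z0 : z != 0.
    apply/eqP => zE; move: zz zr; rewrite zE sub0r normc_opp normc_gt0 /rho => /negPf ->.
    by rewrite lt_min ltxx.
  have [|A HA] := dg (z := z); first by rewrite normc_gt0 z0 (lt_trans zlt).
  exists (A + (2 * e)%:C * z1^*); apply: cdiffD => //.
  apply: cdiff_ext ltr01 _ (cdiff_affine (- ((2 * e)%:C * z1^* * z1)) _ _) => w _.
  by ring.
have cG : ccont G z1.
  apply: ccontD; first by apply: cg; exact: lt_trans r1.
  apply: (@cdiff_cont _ _ _ ((2 * e)%:C * z1^*)).
  apply: cdiff_ext ltr01 _ (cdiff_affine (- ((2 * e)%:C * z1^* * z1)) _ _) => w _.
  by ring.
have rr : 0 < rho / 2 < rho by apply/andP; split; lra.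
have := circle_mean_le rho0 dG cG rr (K := complex.Re (g z1) - e * (rho / 2) ^+ 2).
rewrite GE !subrr normc0 expr0n/= oppr0 addr0 mulr0 addr0.
have : 0 < e * (rho / 2) ^+ 2 by rewrite mulr_gt0// exprn_gt0// divr_gt0.
move=> er0 /(_ _) H; suff : complex.Re (g z1) <= complex.Re (g z1) - e * (rho / 2) ^+ 2 by lra.
apply: H => w wr; rewrite GE wr.
have /vmax : normc w <= r by apply/ltW/zdisk; rewrite wr; lra.
by lra.
Unshelve. all: by end_near. Qed.

End MaximumPrinciple.

Section Schwarz.
Variable R : realType.

(** The maximum principle concerns real parts, so |h| is controlled through Re (lam h) for all
    unimodular lam. Next, Re (conj c h) is at most 1 and equals 1 at 0, hence equals 1 on every
    circle, and |h| <= 1 leaves no room for an imaginary part. *)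
Lemma schwarz_rotation (phi : R[i] -> R[i]) :
  holomorphic_on_disk phi ->
  (forall z, unit_disk z -> unit_disk (phi z)) -> phi 0 = 0 ->
  normc (derive1 phi 0) = 1 ->
  forall z, unit_disk z -> phi z = derive1 phi 0 * z.
Proof.
move=> hol disk phi0 c1.
set c := derive1 phi 0 in c1 *.
(* The value [c] at 0 fills the removable singularity continuously, by definition of the
   derivative. *)
pose h z := if z == 0 then c else phi z / z.
have h0 : h 0 = c by rewrite /h eqxx.
have hE z : phi z = h z * z.
  by rewrite /h; case: eqP => [->|/eqP z0]; rewrite ?phi0 ?mulr0// mulfVK.
have D0 : unit_disk (0 : R[i]) by apply/unit_diskE; rewrite normc0.
have dh z : 0 < normc z < 1 -> exists A, cdiff h z A.
  rewrite normc_gt0 => /andP[z0 z1].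
  have dphi : derivable phi z 1 by apply/hol/unit_diskE.
  have dinv : derivable (fun w : R[i] => w^-1) z 1.
    exact: (@derivableV R[i] R[i] id z 1 z0 (@derivable_id R[i] R[i] z 1)).
  have /derivable_cdiff H := @derivableM R[i] R[i] _ _ z 1 dphi dinv.
  eexists; apply: (@cdiff_ext _ _ _ _ _ (normc z)) H; first by rewrite normc_gt0.
  move=> w wz; rewrite /h; case: eqP => // w0; move: wz.
  by rewrite w0 sub0r normc_opp ltxx.
have ch z : normc z < 1 -> ccont h z.
  move=> z1; have [->|z0] := eqVneq z 0; last first.
    have [|A] := dh z; first by rewrite normc_gt0 z0.
    exact: cdiff_cont.
  move=> e e0; have [d d0 H] := derivable_cdiff (hol _ D0) e0.
  exists d => // w /H; rewrite phi0 !subr0 h0 hE -mulrBl normcM.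
  have [->|w0] := eqVneq w 0; last by rewrite ler_pM2r// normc_gt0.
  by move=> _; rewrite h0 subrr normc0 ltW.
have hle lam : normc lam = 1 -> forall z, normc z < 1 -> complex.Re (lam * h z) <= 1.
  move=> lam1 z z1.
  have dlh w : 0 < normc w < 1 -> exists A, cdiff (fun w => lam * h w) w A.
    move=> /dh[A HA]; exists (lam * A).
    apply: (cdiff_comp (g := fun w => lam * w)) => //.
    apply: cdiff_ext ltr01 _ (cdiff_affine 0 lam _) => u _.
    by rewrite add0r.
  have clh w : normc w < 1 -> ccont (fun w => lam * h w) w.
    by move=> /ch; exact: ccont_scale.
  (* On the circle of radius r, |phi| < 1 gives |h| <= 1 / r. *)
  have bound r : normc z < r < 1 -> complex.Re (lam * h z) <= r^-1.
    move=> /andP[zr r1].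
    have r0 : 0 < r by rewrite (le_lt_trans _ zr)// normc_ge0.
    apply: (max_principle dlh clh (r := r)); rewrite ?r0//; last exact: ltW.
    move=> w wr; apply: le_trans (ler_norm _) _; apply: le_trans (Re_le_normc _) _.
    rewrite normcM lam1 mul1r -[leRHS]mul1r ler_pdivlMr// -wr -normcM -hE.
    by apply/ltW/unit_diskE/disk/unit_diskE; rewrite wr.
  set t := complex.Re _ in bound *; rewrite leNgt; apply/negP => t1.
  (* If t > 1, a radius larger than both |z| and 1 / t contradicts t <= 1 / r. *)
  pose r := Num.max ((1 + normc z) / 2) ((1 + t^-1) / 2).
  have t0 : 0 < t by lra.
  have tV1 : t^-1 < 1 by rewrite invf_lt1.
  have zr : normc z < r by rewrite lt_max; apply/orP; left; lra.
  have r1 : r < 1 by rewrite gt_max; apply/andP; split; lra.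
  have tr : t^-1 < r by rewrite lt_max; apply/orP; right; lra.
  have := bound r; rewrite zr r1 => /(_ isT); rewrite leNgt => /negP; apply.
  by rewrite invf_plt// posrE (lt_trans _ tr)// invr_gt0.
have cc1 : c^* * c = 1.
  by apply: complex_ext; have := sqr_normcE c; rewrite c1; case: (c) => a b /=; lra.
have nJ (z : R[i]) : normc z^* = normc z by case: z => a b; rewrite /normc/= sqrrN.
have key z : unit_disk z -> complex.Re (c^* * h z) = 1.
  move=> /unit_diskE z1.
  have [->|z0] := eqVneq z 0; first by rewrite h0 cc1.
  have dch w : 0 < normc (w - 0) < 1 -> exists A, cdiff (fun w => c^* * h w) w A.
    rewrite subr0 => /dh[A HA]; exists (c^* * A).
    apply: (cdiff_comp (g := fun w => c^* * w)) => //.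
    apply: cdiff_ext ltr01 _ (cdiff_affine 0 (c^*) _) => u _.
    by rewrite add0r.
  have cch : ccont (fun w => c^* * h w) 0 by apply: ccont_scale; apply: ch; rewrite normc0.
  apply: (@circle_mean_eq _ (fun w => c^* * h w) 0 1 ltr01 dch cch (normc z) 1).
  - by rewrite normc_gt0 z0.
  - by move=> w; rewrite subr0 => wz; apply: hle; rewrite ?nJ ?wz.
  - by rewrite h0 cc1.
  - by rewrite subr0.
move=> z Dz; rewrite hE; congr (_ * _); have := key z Dz.
move/unit_diskE : (Dz) => z1.
set k := c^* * h z => Rek.
have kh : h z = c * k by rewrite /k mulrA [c * _]mulrC cc1 mul1r.
clearbody k.
suff Imk : complex.Im k = 0.
  by rewrite kh (_ : k = 1) ?mulr1//; apply: complex_ext.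
have k0 : k != 0 by apply/eqP => k0; move: Rek; rewrite k0 /=; lra.
have nk0 : 0 < normc k by rewrite normc_gt0.
(* This unimodular factor turns h z = c k into |k|, so |k| <= 1; with Re k = 1 this forces Im k =
   0. *)
have := hle (k^* / (normc k)%:C * c^*) _ z z1; rewrite kh.
have -> : k^* / (normc k)%:C * c^* * (c * k) = (normc k)%:C.
  rewrite mulrA -[_ * c^* * c]mulrA cc1 mulr1.
  have -> : k^* / (normc k)%:C * k = (k^* * k) / (normc k)%:C by ring.
  have -> : k^* * k = (normc k ^+ 2)%:C.
    by apply: complex_ext; rewrite sqr_normcE; case: (k) => a b /=; ring.
  by rewrite rmorphXn/= expr2 mulfK// eq_complex/= eqxx andbT gt_eqF.
move=> /(_ _)/= H; have {}H : normc k <= 1.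
  apply: H; rewrite !normcM normcV !nJ c1 mulr1 normc_real gtr0_norm// divff//.
  by rewrite gt_eqF.
have : normc k ^+ 2 <= 1 by rewrite expr_le1// ltW.
rewrite sqr_normcE Rek expr1n gerDl => Ik.
by apply/eqP; rewrite -sqrf_eq0 eq_le Ik sqr_ge0.
Qed.

End Schwarz.

(** * Rotations of the circle *)

Section CircleRotation.
Variable R : realType.
Implicit Types (t s : borel_circle R) (z : R[i]).

Lemma normc_circle t : normc (circle_val t) = 1.
Proof. by apply/unit_circleE; case: t => z p; exact: set_mem p. Qed.

Lemma circle_val_inj : injective (@circle_val R).
Proof. by move=> [x xp] [y yp] /= xy; apply: val_inj. Qed.

Lemma rotate_subproof (c : R[i]) t : normc c = 1 -> c * circle_val t \in @unit_circle R.
Proof. by move=> c1; apply/mem_set/unit_circleE; rewrite normcM c1 normc_circle mulr1. Qed.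

Definition rotate (c : R[i]) (c1 : normc c = 1) t : borel_circle R :=
  (exist _ (c * circle_val t) (rotate_subproof t c1) : set_type (@unit_circle R)).

Lemma rotateE c (c1 : normc c = 1) t : circle_val (rotate c1 t) = c * circle_val t.
Proof. by []. Qed.

Lemma iter_rotate c (c1 : normc c = 1) k t :
  circle_val (iter k (rotate c1) t) = c ^+ k * circle_val t.
Proof.
elim: k => [|k IH]; first by rewrite expr0 mul1r.
by rewrite iterS rotateE IH exprS mulrA.
Qed.

Lemma nbhs_normc z (e : R) : 0 < e -> nbhs z [set w | normc (w - z) < e].
Proof.
move=> e0; exists e%:C => /=; first by rewrite ltcR.
by move=> w /=; rewrite normc_distC /ball_/= normcE ltcR.
Qed.

Lemma circle_open (U : set (circle R)) :
  (forall t, U t -> exists2 e, 0 < e &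
    forall s, normc (circle_val s - circle_val t) < e -> U s) -> open U.
Proof.
move=> HU; rewrite openE => t /HU[e e0 He].
have cv : {for t, continuous (set_val : set_type (@unit_circle R) -> R[i])}.
  exact: initial_continuous.
have H : \forall s \near (t : circle R), normc (circle_val s - circle_val t) < e.
  exact: (cv _ (nbhs_normc (circle_val t) e0)).
exact: (filterS He H).
Qed.

Lemma open_measurable_circle (U : set (borel_circle R)) :
  @open (circle R) U -> measurable U.
Proof. by move=> oU; exact: sub_sigma_algebra. Qed.

Lemma measurable_circle1 t : measurable [set t].
Proof.
rewrite -[X in measurable X]setCK; apply: measurableC.
apply: open_measurable_circle; apply: circle_open => s st.
exists (normc (circle_val t - circle_val s)).
  by rewrite normc_gt0 subr_eq0; apply/eqP => /circle_val_inj ts; exact: st.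
by move=> u + ut; rewrite ut ltxx.
Qed.

Lemma measurable_circle_fun (f : R[i] -> R[i]) :
  (forall t, ccont f (circle_val t)) ->
  measurable_fun setT (fun t => complex.Re (f (circle_val t))) /\
  measurable_fun setT (fun t => complex.Im (f (circle_val t))).
Proof.
move=> cf; split;
  apply: (measurability _ (RGenOpens.measurableE R)) => _ [_ [x [y ->]] <-];
  rewrite setTI; apply: open_measurable_circle; apply: circle_open => t /=;
  rewrite in_itv/= => /andP[h1 h2].
- set u := complex.Re _ in h1 h2; pose e := Num.min (u - x) (y - u).
  have e0 : 0 < e by rewrite lt_min !subr_gt0 h1.
  have [|d d0 Hd] := cf t (e / 2); first by rewrite divr_gt0.
  exists d => // s /Hd /(le_trans (Re_le_normc _)); rewrite ReD ReN -/u in_itv/=.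
  have : e <= u - x by rewrite ge_min lexx.
  have : e <= y - u by rewrite ge_min lexx orbT.
  by rewrite ler_norml => ? ? /andP[? ?]; apply/andP; split; lra.
- set u := complex.Im _ in h1 h2; pose e := Num.min (u - x) (y - u).
  have e0 : 0 < e by rewrite lt_min !subr_gt0 h1.
  have [|d d0 Hd] := cf t (e / 2); first by rewrite divr_gt0.
  exists d => // s /Hd /(le_trans (Im_le_normc _)); rewrite ImD ImN -/u in_itv/=.
  have : e <= u - x by rewrite ge_min lexx.
  have : e <= y - u by rewrite ge_min lexx orbT.
  by rewrite ler_norml => ? ? /andP[? ?]; apply/andP; split; lra.
Qed.

Lemma measurable_rotate c (c1 : normc c = 1) : measurable_fun setT (rotate c1).
Proof.
have H := @measurability _ _ (borel_circle R) (borel_circle R) setT (rotate c1) (@open (circle R)).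
apply: H => // _ [U oU <-].
rewrite setTI; apply: open_measurable_circle; apply: circle_open => t Ut.
have : nbhs (rotate c1 t : circle R) U by apply: open_nbhs_nbhs.
(* A neighborhood on the circle contains the trace of an open set W of R[i], in which a ball can be
   found. *)
rewrite /nbhs/= => -[V [[W oW WV] Vt VU]].
have /nbhs_normP[e /= e0 He] : nbhs (c * circle_val t) W.
  by apply: open_nbhs_nbhs; split=> //; rewrite -WV in Vt.
have eE : e = (complex.Re e)%:C.
  by apply/complex_ext => //=; move: e0; rewrite ltcE/= => /andP[/eqP->].
exists (complex.Re e); first by rewrite -ltcR -eE.
move=> s st; apply: VU; rewrite -WV; apply: He => /=.
by rewrite normcE eE ltcR -mulrBr normcM c1 mul1r normc_distC.
Qed.

Lemma disk_approach t (e : R) : 0 < e ->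
  exists2 z : R[i], unit_disk z & normc (z - circle_val t) < e.
Proof.
move=> e0; pose k := Num.min (e / 2) 1.
have k0 : 0 < k by rewrite lt_min ltr01 divr_gt0.
have k1 : k <= 1 by rewrite ge_min lexx orbT.
have ke : k < e by have : k <= e / 2 by [rewrite ge_min lexx]; lra.
exists ((1 - k)%:C * circle_val t).
  by apply/unit_diskE; rewrite normcM normc_circle mulr1 normc_real ger0_norm; lra.
have -> : (1 - k)%:C * circle_val t - circle_val t = (- k)%:C * circle_val t.
  by rewrite rmorphB rmorph1 rmorphN; ring.
by rewrite normcM normc_circle mulr1 normc_real normrN gtr0_norm.
Qed.

(** Multiplication by c is continuous, so the limit at w exists and is c w; the default value of
    [boundary_map] is never taken. *)
Lemma boundary_mapE (phi : R[i] -> R[i]) c (c1 : normc c = 1) :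
  (forall z, unit_disk z -> phi z = c * z) -> boundary_map phi = rotate c1.
Proof.
move=> phiE; apply/funext => w.
have H : phi z @[z --> within (@unit_disk R) (nbhs (circle_val w))] -->
    circle_val (rotate c1 w).
  apply/cvgrPdist_lt => e e0; rewrite near_withinE; near=> z => Dz.
  rewrite phiE// rotateE -mulrBr normrM normcE c1 mul1r.
  by near: z; apply: cvgr_dist_lt.
apply: xget_unique => /=.
  exact: H.
move=> v vlim; apply: circle_val_inj.
(* The disk accumulates at w, which makes the filter proper and its limits unique. *)
have cl : closure (@unit_disk R) (circle_val w).
  move=> U /nbhs_normP[e /= e0 He].
  have eE : e = (complex.Re e)%:C.
    by apply/complex_ext => //=; move: e0; rewrite ltcE/= => /andP[/eqP->].
  have [|z Dz zw] := @disk_approach w (complex.Re e); first by rewrite -ltcR -eE.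
  by exists z; split=> //; apply: He; rewrite /= normcE eE ltcR normc_distC.
have pF := @within_nbhs_proper _ (@unit_disk R) (circle_val w) cl.
apply: (@cvg_unique _ (@norm_hausdorff R[i] R[i]) _ _ _ _ vlim).
exact: H.
Unshelve. all: by end_near. Qed.

End CircleRotation.

(** * Herglotz and Poisson integrals under rotation *)

Section RotationInvariance.
Variables (R : realType) (mu : {measure set (borel_circle R) -> \bar R}).

(** The Herglotz kernel; for |t| = 1 its real part is the Poisson kernel. *)
Definition herglotz (z t : R[i]) : R[i] := (t + z) / (t - z).

Definition poisson (z : R[i]) : R := \int[mu]_t complex.Re (herglotz z (circle_val t)).

Lemma singular_innerE z : singular_inner mu z =
  cexp (- (poisson z +i* \int[mu]_t complex.Im (herglotz z (circle_val t)))).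
Proof. by []. Qed.

Lemma normc_singular_inner z : normc (singular_inner mu z) = expR (- poisson z).
Proof. by rewrite singular_innerE normc_cexp. Qed.

Lemma ccont_herglotz z t : normc z < 1 -> normc t = 1 -> ccont (herglotz z) t.
Proof.
move=> z1 t1.
have tz : t - z != 0.
  by rewrite subr_eq0; apply: contraTneq z1 => <-; rewrite t1 ltxx.
have did := @derivable_id R[i] R[i] t 1.
have d1 := @derivableD R[i] R[i] R[i] id (cst z) t 1 did (derivable_cst _ _ _).
have d2 := @derivableD R[i] R[i] R[i] id (cst (- z)) t 1 did (derivable_cst _ _ _).
have d3 := @derivableV R[i] R[i] _ t 1 tz d2.
have /derivable_cdiff := @derivableM R[i] R[i] _ _ t 1 d1 d3.
exact: cdiff_cont.
Qed.

Lemma measurable_herglotz z : normc z < 1 ->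
  measurable_fun setT (fun t : borel_circle R => complex.Re (herglotz z (circle_val t))) /\
  measurable_fun setT (fun t : borel_circle R => complex.Im (herglotz z (circle_val t))).
Proof.
move=> z1; apply: measurable_circle_fun => t.
by apply: ccont_herglotz => //; exact: normc_circle.
Qed.

Lemma herglotz_rotate c z (t : R[i]) : normc c = 1 -> herglotz (c * z) (c * t) = herglotz z t.
Proof.
move=> c1; rewrite /herglotz -mulrDr -mulrBr -mulf_div divff ?mul1r//.
by rewrite -normc_gt0 c1.
Qed.

Variables (c : R[i]) (c1 : normc c = 1).

(** Invariance says that the push-forward of [mu] is [mu]. Nonnegative functions come first; the
    general case follows from positive and negative parts. *)
Lemma Rintegral_rotate (f : borel_circle R -> R) :
  (forall B, measurable B -> mu (rotate c1 @^-1` B) = mu B) ->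
  measurable_fun setT f -> \int[mu]_t f t = \int[mu]_t f (rotate c1 t).
Proof.
move=> inv mf; rewrite /Rintegral; congr fine.
have mrot := measurable_rotate c1.
have mEf : measurable_fun setT (EFin \o f) by exact/measurable_EFinP.
have pos (g : borel_circle R -> \bar R) : measurable_fun setT g ->
    (forall t, 0 <= g t)%E -> (\int[mu]_t g t = \int[mu]_t (g \o rotate c1) t)%E.
  move=> mg g0; rewrite -[RHS](ge0_integral_pushforward mrot mu measurableT)//.
  by apply: eq_measure_integral => A mA _; rewrite -inv.
rewrite integralE [RHS]integralE; congr (_ - _)%E.
- rewrite (pos _ (measurable_funepos mEf)) => [|t]; last exact: funepos_ge0.
  by apply: eq_integral => t _; rewrite /= !funeposE.
- rewrite (pos _ (measurable_funeneg mEf)) => [|t]; last exact: funeneg_ge0.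
  by apply: eq_integral => t _; rewrite /= !funenegE.
Qed.

(** The kernel depends only on z / t, so replacing t by c t in the integral at c z gives the
    integral at z. *)
Lemma singular_inner_rotate z : normc z < 1 ->
  (forall B, measurable B -> mu (rotate c1 @^-1` B) = mu B) ->
  singular_inner mu (c * z) = singular_inner mu z.
Proof.
move=> z1 inv.
have cz1 : normc (c * z) < 1 by rewrite normcM c1 mul1r.
have [mRe mIm] := measurable_herglotz cz1.
rewrite !singular_innerE /poisson (Rintegral_rotate inv mRe) (Rintegral_rotate inv mIm).
under eq_Rintegral do rewrite rotateE herglotz_rotate//.
by under [X in _ +i* X]eq_Rintegral do rewrite rotateE herglotz_rotate//.
Qed.

End RotationInvariance.

Section OrbitMass.
Variables (R : realType) (phi : R[i] -> R[i]) (c : R[i]) (c1 : normc c = 1).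
Hypothesis phiE : boundary_map phi = rotate c1.

(** Pulling B back advances every Dirac mass by one step, and the last one returns to the first
    because c ^+ n.+1 = 1. The successor form lets the sum be split at either end. *)
Lemma orbit_mass_rotate n (I : set nat) (a : nat -> R) (w : nat -> borel_circle R) B :
  c ^+ n.+1 = 1 ->
  orbit_mass phi n.+1 I a w (rotate c1 @^-1` B) = orbit_mass phi n.+1 I a w B.
Proof.
move=> cn; rewrite /orbit_mass phiE; apply: eq_esum => m _; congr (_ * _)%E.
have dirac_rotate x : \d_x (rotate c1 @^-1` B) = \d_(rotate c1 x) B :> \bar R.
  by rewrite !diracE; congr (_%:R%:E); apply/idP/idP; rewrite !inE.
rewrite big_ord_recr/= [RHS]big_ord_recl/= addeC; congr (_ + _)%E.
  rewrite dirac_rotate; suff -> : rotate c1 (iter n (rotate c1) (w m)) = w m by [].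
  by apply: circle_val_inj; rewrite -iterS iter_rotate cn mul1r.
Qed.

End OrbitMass.

(** * Atoms and orbits *)

Section Atoms.
Variables (R : realType) (mu : {finite_measure set (borel_circle R) -> \bar R}).

Lemma Re_herglotz (z t : R[i]) : normc t = 1 -> normc z < 1 ->
  complex.Re (herglotz z t) = (1 - normc z ^+ 2) / normc (t - z) ^+ 2.
Proof.
move=> t1 z1.
have tz : 0 < normc (t - z) ^+ 2.
  rewrite exprn_gt0// normc_gt0 subr_eq0; apply: contraTneq z1 => <-.
  by rewrite t1 ltxx.
have := sqr_normcE t; rewrite t1 expr1n; move: tz.
rewrite /herglotz !sqr_normcE; case: t t1 => a b _; case: z z1 => x y _ /=.
by move=> q0 ab; rewrite ab; field; rewrite gt_eqF.
Qed.

(** The distance from the k-th radial point to the circle; the shift by 2 keeps it strictly between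
    0 and 1, even for k = 0. *)
Let s (k : nat) : R := k.+2%:R^-1.

Let s_gt0 k : 0 < s k. Proof. by rewrite invr_gt0. Qed.

Let s_lt1 k : s k < 1. Proof. by rewrite invf_lt1// ltr1n. Qed.

Let s_cvg0 e : 0 < e -> \forall k \near \oo, s k < e.
Proof.
move=> e0; near=> k; rewrite /s.
apply: (@le_lt_trans _ _ k.+1%:R^-1).
  by rewrite lef_pV2 ?posrE// ler_nat.
by near: k; exact: near_infty_natSinv_lt (PosNum e0).
Unshelve. all: by end_near. Qed.

Let inner (t0 : borel_circle R) k : R[i] := (1 - s k)%:C * circle_val t0.

Let normc_inner t0 k : normc (inner t0 k) = 1 - s k.
Proof.
by rewrite normcM normc_circle mulr1 normc_real ger0_norm// subr_ge0 ltW.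
Qed.

Let inner_lt1 t0 k : normc (inner t0 k) < 1.
Proof. by rewrite normc_inner ltrBlDr ltrDl. Qed.

(* Normalized so that its values lie in [0, 1] and tend to the indicator
   of t0. *)
Let peak (t0 : borel_circle R) k (t : borel_circle R) : R :=
  s k / (2 - s k) * complex.Re (herglotz (inner t0 k) (circle_val t)).

(** With r = 1 - s, the factor (1 - r) / (1 + r) is s / (2 - s) and 1 - r^2 is s (2 - s), so the
    normalized Poisson kernel is a square. *)
Let peakE t0 k t :
  peak t0 k t = (s k / normc (circle_val t - inner t0 k)) ^+ 2.
Proof.
have s0 := s_gt0 k; have s1 := s_lt1 k.
rewrite /peak Re_herglotz ?normc_circle// normc_inner expr_div_n mulrA.
by congr (_ / _); field; rewrite subr_eq0 gt_eqF//; lra.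
Qed.

Let peak_ge0 t0 k t : 0 <= peak t0 k t.
Proof. by rewrite peakE sqr_ge0. Qed.

Let dist_ge t0 k t : s k <= normc (circle_val t - inner t0 k).
Proof.
have := normc_triangle (circle_val t - inner t0 k) (inner t0 k).
by rewrite subrK normc_circle normc_inner; lra.
Qed.

Let peak_le1 t0 k t : peak t0 k t <= 1.
Proof.
have d0 := lt_le_trans (s_gt0 k) (dist_ge t0 k t).
have q0 : 0 <= s k / normc (circle_val t - inner t0 k) by rewrite divr_ge0// ltW.
by rewrite peakE expr_le1// ler_pdivrMr// mul1r dist_ge.
Qed.

Let peak_cvg t0 t : (peak t0 k t)%:E @[k --> \oo] --> (\1_[set t0] t)%:E.
Proof.
apply: cvg_EFin; first by near=> k.
have [->|tt0] := pselect (t = t0).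
  rewrite indicE mem_set//=; apply: cvg_near_cst; near=> k => /=.
  rewrite peakE /inner; have -> : circle_val t0 - (1 - s k)%:C * circle_val t0 =
     (s k)%:C * circle_val t0 by rewrite rmorphB rmorph1; ring.
  rewrite normcM normc_circle mulr1 normc_real gtr0_norm// divff ?expr1n//.
  by rewrite gt_eqF.
rewrite indicE memNset//=; apply/cvgrPdist_le => e e0.
pose D := normc (circle_val t - circle_val t0).
have D0 : 0 < D.
  by rewrite normc_gt0 subr_eq0; apply/eqP => /circle_val_inj.
near=> k; rewrite sub0r normrN (ger0_norm (peak_ge0 t0 k t)).
have s0 := s_gt0 k; have s1 := s_lt1 k.
(* By the triangle inequality t is then at distance at least D - s >= D / 2 from the radial point,
   and the next bound makes s divided by that distance at most e. *)
have sD : s k < D / 2 by near: k; apply: s_cvg0; rewrite divr_gt0.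
have se : s k < e * D / 2 by near: k; apply: s_cvg0; rewrite !mulr_gt0.
have dD : D / 2 <= normc (circle_val t - inner t0 k).
  have := normc_triangle (circle_val t - inner t0 k) (inner t0 k - circle_val t0).
  have -> : circle_val t - inner t0 k + (inner t0 k - circle_val t0) =
     circle_val t - circle_val t0 by ring.
  have -> : inner t0 k - circle_val t0 = (- s k)%:C * circle_val t0.
    by rewrite /inner rmorphB rmorph1 rmorphN; ring.
  rewrite normcM normc_circle mulr1 normc_real normrN gtr0_norm// -/D; lra.
have d0 := lt_le_trans (s_gt0 k) (dist_ge t0 k t).
rewrite peakE; set q := _ / _.
have q0 : 0 <= q by rewrite divr_ge0// ltW.
have q1 : q <= 1 by rewrite ler_pdivrMr// mul1r dist_ge.
have qe : q <= e.
  rewrite ler_pdivrMr// (le_trans (ltW se))// -mulrA ler_pM2l//.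
by rewrite expr2 (le_trans _ qe)// ler_piMr.
Unshelve. all: by end_near. Qed.

(** Dominated convergence for the peaks, with the constant 1 as dominating function, integrable
    because [mu] is finite. *)
Lemma poisson_peak t0 :
  (fun k => s k / (2 - s k) * poisson mu (inner t0 k)) @ \oo --> fine (mu [set t0]).
Proof.
have mpeak k : measurable_fun setT (peak t0 k).
  have [mRe _] := measurable_herglotz (inner_lt1 t0 k).
  by apply: measurable_funM => //; exact: measurable_cst.
have fmu : (mu setT < +oo)%E by rewrite ltey_eq fin_num_measure.
have ipeak k : mu.-integrable setT (EFin \o peak t0 k).
  apply: measurable_bounded_integrable => //.
  exists 1; split => // M M1 t _ /=; rewrite ger0_norm//.
  exact: le_trans (ltW M1).
have i1 : mu.-integrable setT (cst 1%:E : borel_circle R -> \bar R).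
  exact: finite_measure_integrable_cst.
have m1 : measurable_fun setT (fun t => (\1_[set t0] t)%:E : \bar R).
  apply/measurable_EFinP; apply: measurable_indic; exact: measurable_circle1.
have mEpeak k : measurable_fun setT (fun t => (peak t0 k t)%:E : \bar R).
  exact/measurable_EFinP.
have aecvg : {ae mu, forall t, setT t ->
    (fun k => (peak t0 k t)%:E) @ \oo --> (\1_[set t0] t)%:E}.
  by apply: aeW => t _; exact: peak_cvg.
have aedom : {ae mu, forall t k, setT t -> (`|(peak t0 k t)%:E| <= cst 1%:E t)%E}.
  by apply: aeW => t k _; rewrite /= lee_fin ger0_norm.
have [_ _] := dominated_convergence measurableT mEpeak m1 aecvg i1 aedom.
rewrite integral_indic ?setIT//; last exact: measurable_circle1.
set a := fine _; have aE : a%:E = mu [set t0].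
  by rewrite fineK// fin_num_measure//; exact: measurable_circle1.
move=> H; have /fine_cvg : (fun k => \int[mu]_t (peak t0 k t)%:E)%E @ \oo --> a%:E.
  by rewrite aE.
apply: cvg_trans; apply: near_eq_cvg; near=> k => /=.
(* Taking the factor out of the integral uses integrability of the kernel, which at a fixed radius
   is bounded by 2 / s. *)
rewrite -[fine _]/(\int[mu]_t peak t0 k t) RintegralZl//.
apply: measurable_bounded_integrable => //.
  by have [] := measurable_herglotz (inner_lt1 t0 k).
have s0 := s_gt0 k; have s1 := s_lt1 k.
exists (2 / s k); split; first exact: num_real.
move=> M M1 t _ /=; apply: le_trans (ltW M1).
have -> : complex.Re (herglotz (inner t0 k) (circle_val t)) =
    (2 - s k) / s k * peak t0 k t.
  by rewrite /peak; field; rewrite !gt_eqF//; lra.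
have A : (2 - s k) / s k <= 2 / s k by rewrite ler_pM2r ?invr_gt0//; lra.
have B : 0 <= (2 - s k) / s k by rewrite divr_ge0 ?(ltW s0)//; lra.
by rewrite normrM (ger0_norm (peak_ge0 _ _ _)) (ger0_norm B) -[leRHS]mulr1 ler_pM.
Unshelve. all: by end_near. Qed.


(** The radial points toward c t are c times those toward t, so both masses are limits of the same
    sequence. *)
Lemma atom_rotate c (c1 : normc c = 1) t :
  (forall z, normc z < 1 -> poisson mu (c * z) = poisson mu z) ->
  mu [set rotate c1 t] = mu [set t].
Proof.
move=> inv; have fin u : mu [set u] \is a fin_num.
  by apply: fin_num_measure; exact: measurable_circle1.
rewrite -[LHS]fineK// -[RHS]fineK//; congr _%:E.
have := @poisson_peak (rotate c1 t).
have -> : (fun k => s k / (2 - s k) * poisson mu (inner (rotate c1 t) k)) =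
    (fun k => s k / (2 - s k) * poisson mu (inner t k)).
  by apply/funext => k; rewrite /inner rotateE mulrCA inv//; exact: inner_lt1.
by move=> /cvg_lim <-//; apply: cvg_lim => //; exact: poisson_peak.
Qed.

End Atoms.

Section Enumeration.
Local Open Scope card_scope.

(** Taking all of nat or an initial segment as index set covers infinite, finite and empty sequences
    alike. *)
Lemma countable_enum (T : pointedType) (W : set T) : countable W ->
  exists (I : set nat) (w : nat -> T),
    (I = setT \/ exists N, I = `I_N) /\ set_bij I W w.
Proof.
move=> cW; have [/finite_setP[N]|/infiniteP WN] := pselect (finite_set W).
  by move=> /card_esym/card_set_bijP[w ?]; exists `I_N, w; split => //; right; exists N.
have : [set: nat] #= W by rewrite card_eq_le WN.
by move=> /card_set_bijP[w ?]; exists setT, w; split => //; left.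
Qed.

End Enumeration.

(** * Decomposition of a discrete measure with rotation-invariant atoms *)

Section OrbitDecomposition.
Variables (R : realType) (mu : {finite_measure set (borel_circle R) -> \bar R}).
Variables (c : R[i]) (c1 : normc c = 1) (n : nat).
Hypothesis cn : n.-primitive_root c.
Hypothesis mu_discrete : discrete_measure mu.
Hypothesis atom_rot : forall t, mu [set rotate c1 t] = mu [set t].
Implicit Types (t u : borel_circle R) (B : set (borel_circle R)).

Let rot := rotate c1.

Let orbit t : set (borel_circle R) := [set iter k rot t | k in `I_n].

Let n_gt0 : (0 < n)%N. Proof. exact: prim_order_gt0 cn. Qed.

Let orbit_refl t : orbit t t. Proof. by exists 0. Qed.

Let iter_orbit k t : orbit t (iter k rot t).
Proof.
exists (k %% n)%N; first by rewrite /= ltn_mod.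
by apply: circle_val_inj; rewrite !iter_rotate prim_expr_mod.
Qed.

(** Primitivity makes the n points of an orbit distinct, so each is counted once in the sum of Dirac
    masses. *)
Let iter_inj t : {in `I_n &, injective (fun k => iter k rot t)}.
Proof.
move=> i j /set_mem/= ni /set_mem/= nj /(congr1 (@circle_val R)); rewrite !iter_rotate.
have t0 : circle_val t != 0 by rewrite -normc_gt0 normc_circle.
by move=> /(mulIf t0)/eqP; rewrite (eq_prim_root_expr cn) !modn_small// => /eqP.
Qed.

Let orbit_sub t u : orbit t u -> orbit u `<=` orbit t.
Proof. by move=> [k _ <-] _ [j _ <-]; rewrite -iterD; exact: iter_orbit. Qed.

(** After k steps, n - k further ones close the orbit. *)
Let orbit_sym t u : orbit t u -> orbit u t.
Proof.
move=> [k /= kn <-].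
have {2}-> : t = iter (n - k) rot (iter k rot t).
  apply: circle_val_inj; rewrite -iterD subnK ?(ltnW kn)// iter_rotate.
  by rewrite (prim_expr_order cn) mul1r.
exact: iter_orbit.
Qed.

Let orbit_eq t u : orbit t u -> orbit u = orbit t.
Proof.
by move=> tu; apply/seteqP; split; apply: orbit_sub => //; exact: orbit_sym.
Qed.

(** [get] depends only on the set it is given, and points of one orbit have equal orbits, so they
    share their representative. *)
Let rep t := get (orbit t).

Let rep_orbit t : orbit t (rep t).
Proof. by apply: getPex; exists t. Qed.

Let rep_rep t : rep (rep t) = rep t.
Proof. by rewrite /rep (orbit_eq (rep_orbit t)). Qed.

Let atoms := [set t | mu [set t] <> 0%E].

Let atom_iter k t : mu [set iter k rot t] = mu [set t].
Proof. by elim: k => [//|k IH]; rewrite iterS atom_rot. Qed.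

Let atom_orbit t u : orbit t u -> mu [set u] = mu [set t].
Proof. by move=> [k _ <-]; exact: atom_iter. Qed.

Let m1 t : measurable [set t]. Proof. exact: measurable_circle1. Qed.

(** A point outside the countable carrier of [mu] has no mass, so all atoms lie in the carrier. *)
Let countable_atoms : countable atoms.
Proof.
have [A cA mA] := mu_discrete; apply: (sub_countable _ cA); apply: subset_card_le.
move=> t; apply: contra_notP => At; apply/eqP; rewrite eq_le measure_ge0 andbT -mA.
apply: le_measure; rewrite ?inE//; last by move=> _ ->.
by apply: measurableC; exact: (countable_measurable m1).
Qed.

Let measurable_atoms : measurable atoms.
Proof. exact: (countable_measurable m1). Qed.

(** There is no mass outside the carrier A, and the points of A that are not atoms are countably
    many null points. *)
Let atomsC0 : mu (~` atoms) = 0%E.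
Proof.
have [A cA mA] := mu_discrete.
have mAm : measurable A by exact: (countable_measurable m1).
apply: measure_negligible; first exact: measurableC.
have nA : mu.-negligible (~` A) by exists (~` A); split => //; exact: measurableC.
suff nD : mu.-negligible (A `&` ~` atoms).
  apply: negligibleS (negligibleU nA nD) => t nt.
  by have [At|nAt] := pselect (A t); [right|left].
have /countable_injP[f finj] := cA.
(* The pieces are fibers of an injection of A into nat, each empty or a null singleton. *)
have : mu.-negligible (\bigcup_k [set t | (A `&` ~` atoms) t /\ f t = k]).
  apply: negligible_bigcup => k.
  have [[u [[Au nu] fu]]|no] := pselect (exists u, (A `&` ~` atoms) u /\ f u = k).
    exists [set u]; split => //; first by move: nu => /contrapT.
    by move=> t [[At nt] ft]; apply: finj; rewrite ?inE// fu.
  by exists set0; split => // t Ht; apply: no; exists t.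
by apply: negligibleS => t Dt; exists (f t).
Qed.

Let mu_point B t : measurable B -> mu (B `&` [set t]) = (mu [set t] * \d_t B)%E.
Proof.
move=> mB; rewrite diracE; have [tB|tB] := pselect (B t).
  by rewrite mem_set// mule1; congr (mu _); apply/seteqP; split => [u []//|u ->].
rewrite memNset// mule0 (_ : _ `&` _ = set0) ?measure0//.
by apply/seteqP; split => // u [] + ut; rewrite ut.
Qed.

(** All points of the orbit have the mass of t, so it suffices to count those in B. *)
Let mu_orbit B t : measurable B ->
  mu (B `&` orbit t) = (mu [set t] * \sum_(k < n) \d_(iter k rot t) B)%E.
Proof.
move=> mB.
have -> : B `&` orbit t = \big[setU/set0]_(k < n) (B `&` [set iter k rot t]).
  rewrite -(bigcup_mkord n (fun k => B `&` [set iter k rot t])).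
  apply/seteqP; split => [u [Bu [k kn ku]]|u [k kn [Bu ku]]].
    by exists k.
  by split=> //; exists k.
rewrite measure_bigsetU_ord//.
- rewrite ge0_sume_distrr//; apply: eq_bigr => k _.
  by rewrite -(atom_iter k) -mu_point.
- by move=> i; exact: measurableI.
- move=> i j _ _ [u [[_ ui] [_ uj]]]; apply/val_inj.
  by apply: (@iter_inj t); rewrite ?inE/= ?ltn_ord// -ui.
Qed.

Lemma orbit_decomposition : exists (I : set nat) (a : nat -> R) (w : nat -> borel_circle R),
  [/\ I = setT \/ (exists N : nat, I = `I_N),
      (forall m, I m -> 0 < a m),
      (\esum_(m in I) (a m)%:E < +oo)%E &
      forall B, measurable B -> mu B =
        (\esum_(m in I) ((a m)%:E * \sum_(k < n) \d_(iter k (rotate c1) (w m)) B))%E].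
Proof.
have [|I [w [HI [wW winj wsurj]]]] := @countable_enum _ (rep @` atoms).
  exact: (sub_countable (card_image_le _ _) countable_atoms).
(* One index for each orbit of atoms, weighted by the common mass of its points. *)
exists I, (fun m => fine (mu [set w m])), w.
have fin u : mu [set u] \is a fin_num by apply: fin_num_measure.
have wrep m : I m -> rep (w m) = w m.
  by move=> /wW[t _ <-]; exact: rep_rep.
have watom m : I m -> mu [set w m] <> 0%E.
  by move=> /wW[t At <-]; rewrite (atom_orbit (rep_orbit t)).
(* Orbits with different indices are disjoint: a common point would give them the same
   representative. *)
have worb i j u : I i -> I j -> orbit (w i) u -> orbit (w j) u -> i = j.
  move=> Ii Ij iu ju; apply: winj; rewrite ?inE//.
  by rewrite -wrep// -[RHS]wrep// /rep -(orbit_eq iu) -(orbit_eq ju).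
split=> //.
- move=> m /watom mw; rewrite fine_gt0// ltey_eq fin andbT lt_neqAle measure_ge0 andbT.
  by rewrite eq_sym; apply/eqP.
(* The weights add up to the mass of the set of representatives, which is finite. *)
- have -> : (\esum_(m in I) (fine (mu [set w m]))%:E = mu (\bigcup_(m in I) [set w m]))%E.
    rewrite measure_bigcup//; last first.
      move=> i j Ii Ij [u [/= iu ju]]; apply: (worb i j u) => //.
        by rewrite iu.
      by rewrite ju.
    rewrite nneseries_esum//; under eq_esum do rewrite fineK//.
    by congr esum; apply/seteqP; split => m; rewrite /= ?inE.
  rewrite ltey_eq fin_num_measure//; exact: bigcup_measurable.
- move=> B mB.
  have atomsE : atoms = \bigcup_(m in I) orbit (w m).
    apply/seteqP; split => t.
      move=> At; have [m Im wm] := wsurj (rep t) (ex_intro2 _ _ t At erefl).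
      by exists m => //; rewrite wm; apply: orbit_sym; exact: rep_orbit.
    by move=> [m Im /atom_orbit]; rewrite /atoms/= => ->; exact: watom.
  have morb t : measurable (orbit t).
    by apply: (countable_measurable m1); exact: (sub_countable (card_image_le _ _) (countableP _)).
  have -> : mu B = mu (B `&` atoms).
    rewrite (measureDI mu mB measurable_atoms) [X in (X + _)%E](_ : _ = 0%E) ?add0e//.
    apply/eqP; rewrite eq_le measure_ge0 andbT -atomsC0.
    apply: le_measure; rewrite ?inE; [exact: measurableD|exact: measurableC|].
    by move=> t [].
  rewrite atomsE setI_bigcupr measure_bigcup.
  + rewrite nneseries_esum//.
    rewrite (_ : [set x | x \in I] = I); last by apply/seteqP; split => m; rewrite /= ?inE.
    by apply: eq_esum => m Im; rewrite fineK// -mu_orbit.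
  + by move=> m _; exact: measurableI.
  + by move=> i j Ii Ij [u [[_ iu] [_ ju]]]; exact: worb iu ju.
Qed.

End OrbitDecomposition.

(** * Invariance of the Poisson integral, and the equivalence *)

Section Eigenfunction.
Variables (R : realType) (mu : {measure set (borel_circle R) -> \bar R}).

Lemma eigenfunction_poisson (phi : R[i] -> R[i]) (c : R[i]) : normc c = 1 ->
  (forall z, unit_disk z -> phi z = c * z) ->
  eigenfunction_of_composition phi (singular_inner mu) ->
  forall z, normc z < 1 -> poisson mu (c * z) = poisson mu z.
Proof.
move=> c1 phiE [lam H].
have {}H z : normc z < 1 ->
    expR (- poisson mu (c * z)) = normc lam * expR (- poisson mu z).
  move=> /unit_diskE Dz; rewrite -!normc_singular_inner -normcM -H//.
  by rewrite /composition_operator/= phiE.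
(* At the fixed point 0 both sides contain the same nonzero exponential. *)
have lam1 : normc lam = 1.
  have := H 0; rewrite mulr0 normc0 => /(_ ltr01) H0.
  apply: (mulIf (lt0r_neq0 (expR_gt0 (- poisson mu 0)))).
  by rewrite mul1r -H0.
by move=> z /H; rewrite lam1 mul1r => /expR_inj/oppr_inj.
Qed.

End Eigenfunction.

Theorem theorem3p7 (R : realType)
    (mu : {finite_measure set (borel_circle R) -> \bar R})
    (phi : R[i] -> R[i]) (n : nat)
    (mu_discrete : discrete_measure mu)
    (phi_elliptic : elliptic_automorphism phi)
    (phi_fix0 : phi 0 = 0)
    (phi_root : n.-primitive_root (derive1 phi 0)) :
  eigenfunction_of_composition phi (singular_inner mu) <->
  exists (I : set nat) (a : nat -> R) (w : nat -> borel_circle R),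
    [/\ I = setT \/ (exists N : nat, I = `I_N),
        (forall m, I m -> 0 < a m),
        (\esum_(m in I) (a m)%:E < +oo)%E &
        forall B : set (borel_circle R), measurable B ->
          mu B = orbit_mass phi n I a w B].
Proof.
have n0 := prim_order_gt0 phi_root.
have cn := prim_expr_order phi_root.
(* The modulus is a nonnegative real whose n-th power is 1, with n positive. *)
have c1 : normc (derive1 phi 0) = 1.
  have /(congr1 (@normc R)) := cn; rewrite normc1 => cn1.
  have {}cn1 : normc (derive1 phi 0) ^+ n = 1.
    rewrite -cn1; elim: (n) => [|k IH]; first by rewrite !expr0 normc1.
    by rewrite !exprS normcM IH.
  by apply/eqP; rewrite -(@eqrXn2 _ n)// ?normc_ge0// cn1 expr1n.
have [[hol disk _] _ _] := phi_elliptic.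
have phiE := schwarz_rotation hol disk phi_fix0 c1.
have bE := boundary_mapE c1 phiE.
split.
  move=> /(eigenfunction_poisson c1 phiE) inv.
  have [|I [a [w [HI a0 asum muE]]]] := orbit_decomposition (c1 := c1) phi_root mu_discrete.
    by move=> t; exact: atom_rotate.
  by exists I, a, w; split => // B mB; rewrite muE// /orbit_mass bE.
(* Orbit sums are rotation-invariant, so S_mu is fixed by the composition operator and the
   eigenvalue is 1. *)
move=> [I [a [w [_ _ _ muE]]]]; exists 1 => z Dz.
rewrite /composition_operator/= phiE// mul1r.
apply: (@singular_inner_rotate _ _ _ c1); first exact/unit_diskE.
move=> B mB.
have mrB : measurable (rotate c1 @^-1` B).
  by rewrite -[X in measurable X]setTI; exact: measurable_rotate.
apply: etrans (muE _ mrB) _; apply: etrans _ (esym (muE _ mB)).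
rewrite -(prednK n0); apply: (orbit_mass_rotate bE).
by rewrite prednK.
Qed.
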